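(* Let $\mathbb{K}$, $\mathcal{S}$, ${\rm mult}(\mathscr{B}(\mathcal{S}))$ and $J_1^L,J_2^L$ be as in the context. There exists a non-empty Zariski open subset $\Omega_{\mathcal{S}}$ of the group of projective transformations of $\mathbb{P}^2(\mathbb{K})$ such that for every $L\in\Omega_{\mathcal{S}}$, $${\rm mult}(\mathscr{B}(\mathcal{S}))=\deg_{\overline t}\Big({\rm Content}_{\overline x}\big({\rm Res}_{t_3}(J_1^L,J_2^L)\big)\Big).$$
   Context: $\mathbb{K}$ is an algebraically closed field of characteristic zero. $\mathcal{S}=(s_1:s_2:s_3):\mathbb{P}^2(\mathbb{K})\dashrightarrow\mathbb{P}^2(\mathbb{K})$ is a dominant rational map with $s_i\in\mathbb{K}[t_1,t_2,t_3]$ homogeneous of the same degree, $\gcd(s_1,s_2,s_3)=1$, and $s_i(0,0,1)\ne0$ for all $i$. $\mathscr{B}(\mathcal{S})$ is the set of common zeros of the $s_i$ in $\mathbb{P}^2(\mathbb{K})$. With indeterminates $\overline x=(x_1,x_2,x_3)$, $\overline y=(y_1,y_2,y_3)$ and $\mathbb{F}$ the algebraic closure of $\mathbb{K}(\overline x,\overline y)$, $V_1=\sum x_is_i$, $V_2=\sum y_is_i$, and ${\rm mult}(\mathscr{B}(\mathcal{S}))=\sum_{A\in\mathscr{B}(\mathcal{S})}{\rm mult}_A(\mathscr{C}(V_1),\mathscr{C}(V_2))$ (intersection multiplicities in $\mathbb{P}^2(\mathbb{F})$). For a projective transformation $L=(L_1:L_2:L_3)$ of $\mathbb{P}^2(\mathbb{K})$,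 with $L_i(\mathcal{S})=L_i(s_1,s_2,s_3)$, $J_1^L=x_3L_1(\mathcal{S})-x_1L_3(\mathcal{S})$ and $J_2^L=x_3L_2(\mathcal{S})-x_2L_3(\mathcal{S})$. ${\rm Res}_{t_3}$ is the resultant w.r.t. $t_3$; ${\rm Content}_{\overline x}(R)$ is the gcd in $\mathbb{K}[t_1,t_2]$ of the coefficients of $R$ as a polynomial in $\overline x$; $\deg_{\overline t}$ is the degree in $t_1,t_2$. *)

(* Defs.v *)
From HB Require Import structures.
From mathcomp Require Import all_boot all_order all_algebra.
From mathcomp Require Import mpoly.
From Stdlib Require List.
Set Implicit Arguments. Unset Strict Implicit. Unset Printing Implicit Defensive.
Import Order.TTheory GRing.Theory.
Local Open Scope ring_scope.

(* Points of P^2 are represented by nonzero vectors 'I_3 -> k.          *)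
Definition nonzero3 (k : nzRingType) (a : 'I_3 -> k) := exists i, a i != 0.
Definition proportional3 (k : nzRingType) (a b : 'I_3 -> k) :=
  exists c : k, c != 0 /\ forall i, a i = c * b i.

Definition rdvd (R : comNzRingType) (d p : R) := exists q, p = q * d.

(* The intersection multiplicity mult_A(C(f),C(g)) at a point A = (a)  *)
(* of P^2(F), of two plane curves given by homogeneous f g in F[t1,t2,t3],
   as dim_F O_A(P^2)/(f_star, g_star) (Fulton).  Elements of the local ring
   O_A(P^2) are fractions p/q with p,q homogeneous of the same degree,
   q(a) <> 0; such a fraction lies in the ideal (f_star, g_star)O_A iff
   w*p = h1*f + h2*g for some polynomials w,h1,h2 with w(a) <> 0.
   [imult_ge f g a n] says that this quotient has n F-linearly
   independent elements (we take all of them with the common denominator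
   l^e, l a linear form with l(a) <> 0, which is no restriction).        *)
Definition in_loc_ideal (F : fieldType) (f g : {mpoly F[3]}) (a : 'I_3 -> F)
    (p : {mpoly F[3]}) :=
  exists w h1 h2 : {mpoly F[3]}, w.@[a] != 0 /\ w * p = h1 * f + h2 * g.

Definition imult_ge (F : fieldType) (f g : {mpoly F[3]}) (a : 'I_3 -> F)
    (n : nat) :=
  exists (e : nat) (ps : 'I_n -> {mpoly F[3]}),
    (forall j, ps j \is e.-homog) /\
    forall c : 'I_n -> F, (exists j, c j != 0) ->
      ~ in_loc_ideal f g a (\sum_(j < n) c j *: ps j).

Definition imult_is (F : fieldType) (f g : {mpoly F[3]}) (a : 'I_3 -> F)
    (n : nat) :=
  imult_ge f g a n /\ ~ imult_ge f g a n.+1.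

Definition same_degree_homog (K : fieldType) (s : 'I_3 -> {mpoly K[3]}) :=
  exists d : nat, forall i, s i \is d.-homog.

Definition coprime3 (K : fieldType) (s : 'I_3 -> {mpoly K[3]}) :=
  forall g : {mpoly K[3]}, (forall i, rdvd g (s i)) ->
    exists c : K, c != 0 /\ g = c%:MP.

Definition e3 (K : nzRingType) : 'I_3 -> K := fun i => if val i == 2%N then 1 else 0.

Definition dominant (K : fieldType) (s : 'I_3 -> {mpoly K[3]}) :=
  forall G : {mpoly K[3]}, G != 0 -> (exists e : nat, G \is e.-homog) ->
    exists t : 'I_3 -> K, (exists i, (s i).@[t] != 0) /\
                         G.@[fun i => (s i).@[t]] != 0.

Definition base_point (K : fieldType) (s : 'I_3 -> {mpoly K[3]}) (a : 'I_3 -> K) :=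
  nonzero3 a /\ forall i, (s i).@[a] = 0.

Definition base_reps (K : fieldType) (s : 'I_3 -> {mpoly K[3]})
    (reps : seq ('I_3 -> K)) :=
  (forall a, List.In a reps -> base_point s a) /\
  (forall b, base_point s b -> exists2 a, List.In a reps & proportional3 b a) /\
  (forall (i j : nat) a, (i < size reps)%N -> (j < size reps)%N -> i != j ->
     ~ proportional3 (nth a reps i) (nth a reps j)).

(* F together with iota : K -> F and x_1,x_2,x_3,y_1,y_2,y_3 in F is an
   algebraic closure of K(x,y), x,y indeterminates:  F is algebraically
   closed, the six elements are algebraically independent over iota(K),
   and every element of F is algebraic over iota(K)(x,y). *)
Definition xy6 (F : Type) (x y : 'I_3 -> F) : 'I_6 -> F :=
  fun i => match split (i : 'I_(3 + 3)) with inl j => x j | inr j => y j end.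

Definition is_alg_closure_Kxy (K : fieldType) (F : closedFieldType)
    (iota : {rmorphism K -> F}) (x y : 'I_3 -> F) :=
  (forall P : {mpoly K[6]}, P != 0 -> (map_mpoly iota P).@[xy6 x y] != 0) /\
  (forall z : F, exists P : {poly {mpoly K[6]}},
     let Q := map_poly (fun q : {mpoly K[6]} => (map_mpoly iota q).@[xy6 x y]) P in
     Q != 0 /\ root Q z).

Definition Vgen (K : fieldType) (F : closedFieldType) (iota : {rmorphism K -> F})
    (s : 'I_3 -> {mpoly K[3]}) (x : 'I_3 -> F) : {mpoly F[3]} :=
  \sum_(i < 3) x i *: map_mpoly iota (s i).

Definition mult_base_is (K : fieldType) (s : 'I_3 -> {mpoly K[3]}) (n : nat) :=
  forall (F : closedFieldType) (iota : {rmorphism K -> F}) (x y : 'I_3 -> F),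
    is_alg_closure_Kxy iota x y ->
    exists (reps : seq ('I_3 -> K)) (ms : seq nat),
      [/\ base_reps s reps, size ms = size reps,
          (forall (i : nat) a, (i < size reps)%N ->
             imult_is (Vgen iota s x) (Vgen iota s y)
                      (fun k => iota (nth a reps i k)) (nth 0%N ms i))
        & (\sum_(m <- ms) m)%N = n].

(* The ring K[t1,t2,x1,x2,x3] (variables numbered 0..4, in that order);
   polynomials in t3 over it are {poly {mpoly K[5]}}.                   *)
Definition tvar (j : 'I_2) : 'I_5 := lshift 3 j.
Definition xvar (j : 'I_3) : 'I_5 := rshift 2 j.

Definition to_t3poly (K : fieldType) (p : {mpoly K[3]}) : {poly {mpoly K[5]}} :=
  mmap (fun c : K => (c%:MP : {mpoly K[5]})%:P)
       (fun i : 'I_3 => nth 'X [:: ('X_(tvar ord0))%:P; ('X_(tvar ord_max))%:P; 'X] i)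
       p.

Definition LS (K : fieldType) (M : 'M[K]_3) (s : 'I_3 -> {mpoly K[3]}) (i : 'I_3)
  : {mpoly K[3]} := \sum_(j < 3) M i j *: s j.

Definition i0 : 'I_3 := ord0.
Definition i1 : 'I_3 := lift ord0 ord0.
Definition i2 : 'I_3 := ord_max.

Definition J1 (K : fieldType) (M : 'M[K]_3) (s : 'I_3 -> {mpoly K[3]}) :=
  ('X_(xvar i2))%:P * to_t3poly (LS M s i0) - ('X_(xvar i0))%:P * to_t3poly (LS M s i2).
Definition J2 (K : fieldType) (M : 'M[K]_3) (s : 'I_3 -> {mpoly K[3]}) :=
  ('X_(xvar i2))%:P * to_t3poly (LS M s i1) - ('X_(xvar i1))%:P * to_t3poly (LS M s i2).

Definition ResJ (K : fieldType) (M : 'M[K]_3) (s : 'I_3 -> {mpoly K[3]}) : {mpoly K[5]} :=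
  resultant (J1 M s) (J2 M s).

Definition coeff_x (K : fieldType) (R : {mpoly K[5]}) (mu : 'X_{1..3}) : {mpoly K[2]} :=
  \sum_(m <- msupp R | [multinom m (xvar j) | j < 3] == mu)
     R@_m *: 'X_[ [multinom m (tvar j) | j < 2] ].

Definition is_content_x (K : fieldType) (R : {mpoly K[5]}) (c : {mpoly K[2]}) :=
  (forall mu, rdvd c (coeff_x R mu)) /\
  (forall d : {mpoly K[2]}, (forall mu, rdvd d (coeff_x R mu)) -> rdvd d c).

Definition deg_t (K : fieldType) (c : {mpoly K[2]}) : nat := (msize c).-1.

(* Non-empty Zariski open subsets of PGL_3(K), represented by their
   (scalar-invariant) preimages in GL_3(K): the complement in GL_3 of the
   common zero set of finitely many polynomials in the 9 matrix entries. *)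
Definition zariski_open_PGL3 (K : fieldType) (Om : 'M[K]_3 -> Prop) :=
  (exists ps : seq {mpoly K[3 * 3]}, forall M : 'M[K]_3,
     Om M <-> (M \in unitmx /\
               exists2 p, p \in ps & p.@[fun i => mxvec M 0 i] != 0)) /\
  (forall (M : 'M[K]_3) (c : K), c != 0 -> Om M -> Om (c *: M)).

(* Main.v *)
(** Let L = M s, where M ranges over the invertible matrices for which L_3 does
    not vanish at (0:0:1).  If z is the cross product of x M^-1 and y M^-1, then
    z is a generic point and the ideal (V_1, V_2) is generated by
    f = z_3 L_1 - z_1 L_3 and g = z_3 L_2 - z_2 L_3, so Res_{t_3}(J_1, J_2)
    specializes at x = z to Res_{t_3}(f, g).  Along each line through (0:0:1) the
    order of this resultant is the sum of the intersection multiplicities of f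
    and g on the line: F[u]_(u)[v]/(f, g) is the cokernel of the Sylvester
    matrix, whose determinant loses exactly one factor u whenever a simple
    submodule F w is divided out.  For lines defined over K the order at z is
    also the multiplicity of the linear form in the content, because z is
    generic, and the common zeros of f and g on such a line are base points:
    otherwise z would lie on the image of the line, a curve defined over K.
    The content, a binary form over K, is a product of such linear forms, and
    summing over the lines gives the formula.  The resultant is nonzero because
    a line without base points exists, the s_i being coprime. *)

Require Import Defs.
From HB Require Import structures.
From mathcomp Require Import all_boot all_order all_algebra.
From mathcomp Require Import mpoly ring zify.
From Stdlib Require Import Classical_Prop.
Set Implicit Arguments. Unset Strict Implicit. Unset Printing Implicit Defensive.
Import GRing.Theory.
Local Open Scope ring_scope.
Local Notation tofrac := (@FracField.tofrac _).

(** The condition on L keeps the Sylvester matrix in shape: the coefficients of t3^d in f and g are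
    z_3 L_i(0:0:1) - z_i L_3(0:0:1) for i = 1, 2. Both are nonzero because z is generic, so the
    degrees in t3 survive specialization and one can divide by f in v. The resultant sees a whole
    line at once, while multiplicities belong to single points. Both are read off one object, a
    composition series of F[u]_(u)[v]/(f, g) whose simple quotients are labelled by points b of the
    line: its length is the order of the determinant, and the number of labels equal to b is the
    dimension of the localization at b. The quotient never has to be split into local factors.
    Neither quotients nor localized rings are formed. Ideals are predicates on F[u][v], and an ideal
    of F[u]_(u)[v] is represented by its trace there. Multiplicities live over F, content and base
    points over K. The common zeros on a line over K descend because they turn out to be roots of
    the restriction of L_3 to that line. *)

(** * Composition series of F[u][v]/I supported on the line u = 0 *)

Section Chains.
Variable F : fieldType.
Local Notation A := {poly {poly F}}.
Implicit Types (I J : A -> Prop) (p q w h : A) (b c : F).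

Record is_ideal I : Prop := IsIdeal {
  ideal0 : I 0;
  idealD : forall p q, I p -> I q -> I (p + q);
  idealM : forall h p, I p -> I (h * p) }.

Lemma idealN I p : is_ideal I -> I p -> I (- p).
Proof. by move=> iI Ip; rewrite -mulN1r; apply: idealM. Qed.

Lemma idealB I p q : is_ideal I -> I p -> I q -> I (p - q).
Proof. by move=> iI Ip Iq; apply: idealD => //; apply: idealN. Qed.

Lemma ideal_sub I p q : is_ideal I -> I (p - q) -> I q -> I p.
Proof. by move=> iI Ipq Iq; rewrite -(subrK q p); apply: idealD. Qed.

Lemma ideal_sum I (T : Type) (r : seq T) (P : pred T) (f : T -> A) :
  is_ideal I -> (forall i, P i -> I (f i)) -> I (\sum_(i <- r | P i) f i).
Proof.
move=> iI If; elim/big_ind: _ => //; first exact: ideal0.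
by move=> p q; apply: idealD.
Qed.

(** In [A] the outer variable is v and the inner one is u; this is the value at (u, v) = (0, b). *)
Definition ev b p : F := p.[b%:P].[0].

Lemma evM b p q : ev b (p * q) = ev b p * ev b q.
Proof. by rewrite /ev !hornerM. Qed.

Lemma evC b c : ev b c%:P%:P = c.
Proof. by rewrite /ev !hornerC. Qed.

Lemma evCp b (h : {poly F}) : ev b h%:P = h.[0].
Proof. by rewrite /ev hornerC. Qed.

Lemma ev1 b : ev b 1 = 1.
Proof. exact: evC. Qed.

Lemma horner0_split (h : {poly F}) : exists k, h = k * 'X + h.[0]%:P.
Proof.
have /factor_theorem[k hk] : root (h - h.[0]%:P) 0.
  by rewrite /root !hornerE subrr.
by exists k; rewrite -[h in LHS](subrK h.[0]%:P) hk subr0.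
Qed.

Lemma ev_split b p :
  exists k1 k2, p = k1 * 'X%:P + k2 * ('X - b%:P%:P) + (ev b p)%:P%:P.
Proof.
have /factor_theorem[k2 hk] : root (p - p.[b%:P]%:P) b%:P.
  by rewrite /root !hornerE subrr.
have [k1 hk1] := horner0_split p.[b%:P].
exists k1%:P, k2; rewrite -[LHS](subrK p.[b%:P]%:P) hk {1}hk1 rmorphD rmorphM /=.
by rewrite addrCA addrA.
Qed.

Definition adjoin I w : A -> Prop := fun p => exists c : F, I (p - c%:P%:P * w).

(** A composition series of A/I built from the bottom: each w spans a simple submodule supported at
    (0, b), and the list records these points with repetition. *)
Inductive chain I : seq F -> Prop :=
| chain_nil : I 1 -> chain I [::]
| chain_cons b bs w : ~ I w -> I ('X%:P * w) -> I (('X - b%:P%:P) * w) ->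
    chain (adjoin I w) bs -> chain I (b :: bs).

Lemma ideal_ev I b w h : is_ideal I -> I ('X%:P * w) -> I (('X - b%:P%:P) * w) ->
  I (h * w - (ev b h)%:P%:P * w).
Proof.
move=> iI Iu Iv; have [k1 [k2 {1}->]] := ev_split b h.
rewrite !mulrDl addrK -!mulrA; apply: idealD => //; exact: idealM.
Qed.

(** Modulo I every h acts on w as the scalar [ev b h], so the F-line through w is already a
    submodule. *)
Lemma ideal_adjoin I b w : is_ideal I -> I ('X%:P * w) ->
  I (('X - b%:P%:P) * w) -> is_ideal (adjoin I w).
Proof.
move=> iI Iu Iv; split.
- by exists 0; rewrite !polyC0 mul0r subr0; apply: ideal0.
- move=> p q [c Ip] [e Iq]; exists (c + e).
  rewrite !polyCD mulrDl opprD addrACA; exact: idealD.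
- move=> h p [c Ip]; exists (ev b h * c).
  apply: (@ideal_sub _ _ (h * (p - c%:P%:P * w))) => //; last exact: idealM.
  have -> : h * p - (ev b h * c)%:P%:P * w - h * (p - c%:P%:P * w) =
     c%:P%:P * (h * w - (ev b h)%:P%:P * w).
    by rewrite !polyCM; ring.
  by apply: idealM => //; apply: ideal_ev.
Qed.

Lemma adjoin_sub I w p : I p -> adjoin I w p.
Proof. by move=> Ip; exists 0; rewrite !polyC0 mul0r subr0. Qed.

Lemma adjoin_gen I w : is_ideal I -> adjoin I w w.
Proof. by move=> iI; exists 1; rewrite !polyC1 mul1r subrr; apply: ideal0. Qed.

(** The trace on A of the extension of I to the local ring at (0, b). *)
Definition loc I b p := exists h, ev b h != 0 /\ I (h * p).

Lemma ideal_loc I b : is_ideal I -> is_ideal (loc I b).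
Proof.
move=> iI; split.
- by exists 1; rewrite ev1 oner_neq0 mulr0; split=> //; apply: ideal0.
- move=> p q [h [nh Ih]] [k [nk Ik]]; exists (h * k).
  rewrite evM mulf_neq0 //; split=> //; rewrite mulrDr; apply: idealD => //.
    by rewrite [h * k]mulrC -mulrA; apply: idealM.
  by rewrite -mulrA; apply: idealM.
- move=> k p [h [nh Ih]]; exists h; split=> //.
  by rewrite mulrCA; apply: idealM.
Qed.

Definition comb n (c : 'I_n -> F) (ps : 'I_n -> A) : A :=
  \sum_(j < n) (c j)%:P%:P * ps j.

Definition basis_mod J n (ps : 'I_n -> A) :=
  (forall c : 'I_n -> F, J (comb c ps) -> forall j, c j = 0) /\
  (forall p, exists c : 'I_n -> F, J (p - comb c ps)).

Lemma basis_mod_eq J J' n (ps : 'I_n -> A) : (forall p, J p <-> J' p) ->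
  basis_mod J ps -> basis_mod J' ps.
Proof.
move=> JJ' [ind spn]; split=> [c /JJ'|p]; first exact: ind.
by have [c /JJ'] := spn p; exists c.
Qed.

(* A class killed by [v - b] vanishes locally at every point other than b, and
   adds exactly one dimension at b. *)
Lemma chain_codim I bs b : is_ideal I -> chain I bs ->
  exists ps : 'I_(count_mem b bs) -> A, basis_mod (loc I b) ps.
Proof.
move=> iI cI; elim: cI iI => {I bs} [I I1|I a bs w nIw Iu Iv _ IH] iI.
  have Iall p : loc I b p.
    by exists 1; rewrite ev1 oner_neq0 mul1r -[p]mulr1; split=> //; apply: idealM.
  exists (fun _ => 0); split=> [c _ []//|p]; by exists (fun _ => 0).
have iI' := ideal_adjoin iI Iu Iv.
have {IH}[ps [ind spn]] := IH iI'.
rewrite /=; have [eab|nab] := eqVneq a b; last first.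
  have Iw : loc I b w.
    exists ('X - a%:P%:P); split=> //.
    by rewrite /ev !hornerE /= subr_eq0 eq_sym.
  rewrite add0n; exists ps; apply: (@basis_mod_eq (loc (adjoin I w) b)) => // p.
  split=> [[h [nh [c Ih]]]|[h [nh Ih]]]; last first.
    by exists h; split=> //; apply: adjoin_sub.
  have [k [nk Ik]] := Iw; exists (k * h); rewrite evM mulf_neq0 //; split=> //.
  apply: (@ideal_sub _ _ (k * (c%:P%:P * w))) => //.
    by rewrite -mulrA -mulrBr; apply: idealM.
  by rewrite mulrCA; apply: idealM.

rewrite add1n; subst b; have iL := ideal_loc a iI.
(* A multiplier that is a unit at (0, a) acts on w as a nonzero scalar, so it cannot bring w into
   I. *)
have nLw : ~ loc I a w.
  move=> [h [nh Ih]]; apply: nIw.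
  have := ideal_ev h iI Iu Iv => /(idealN iI); rewrite opprB.
  move=> /(ideal_sub iI) /(_ Ih) /(idealM iI ((ev a h)^-1)%:P%:P).
  by rewrite mulrA -!polyCM mulVf // mul1r.
have LI' p : loc (adjoin I w) a p <-> exists c, loc I a (p - c%:P%:P * w).
  split=> [[h [nh [c Ih]]]|[c [h [nh Ih]]]]; last first.
    exists h; split=> //.
    apply: (@ideal_sub _ _ (h * (c%:P%:P * w))) => //.
      by rewrite -mulrBr; apply: adjoin_sub.
    by do 2!apply: idealM => //; apply: adjoin_gen.
  exists (c / ev a h), h; split=> //.
  apply: (@ideal_sub _ _ (h * p - c%:P%:P * w)) => //.
  have -> : h * (p - (c / ev a h)%:P%:P * w) - (h * p - c%:P%:P * w) =
     (c / ev a h)%:P%:P * (- (h * w - (ev a h)%:P%:P * w)).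
    by rewrite -{2}(divfK nh c) [(_ * ev a h)%:P]polyCM polyCM; ring.
  by apply: idealM => //; apply: idealN => //; apply: ideal_ev.
pose qs (i : 'I_(count_mem a bs).+1) := if unlift ord0 i is Some j then ps j else w.
have combE (c : 'I_(count_mem a bs).+1 -> F) : comb c qs = (c ord0)%:P%:P * w + comb (fun j => c (lift ord0 j)) ps.
  rewrite /comb big_ord_recl /qs unlift_none; congr (_ + _).
  by apply: eq_bigr => j _; rewrite liftK.
exists qs; split=> [c|p].
  rewrite combE => Lc.
  have c0 j : c (lift ord0 j) = 0.
    apply: (ind (fun j => c (lift ord0 j))); apply/LI'; exists (- c ord0).
    by rewrite !polyCN mulNr opprK addrC.
  move=> j; case: (unliftP ord0 j) => [k ->//|->].
  have := Lc; rewrite /comb big1 => [|k _]; last by rewrite c0 !polyC0 mul0r.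
  rewrite addr0 => Lw; apply/eqP; apply: contraPT isT => nc; case: nLw.
  have := idealM iL ((c ord0)^-1)%:P%:P Lw.
  by rewrite mulrA -!polyCM mulVf // mul1r.
have [c /LI'[e Le]] := spn p.
exists (fun i => if unlift ord0 i is Some j then c j else e).
rewrite combE unlift_none /comb.
under eq_bigr do rewrite liftK.
by rewrite -/(comb c ps) opprD addrA [p - _]addrC -addrA addrC.
Qed.

End Chains.

(** * Replacing one row of a matrix: Cramer's rule *)

Section RowReplacement.
Variables (R : comNzRingType) (n : nat).
Implicit Types (G : 'M[R]_n) (x : 'rV[R]_n) (j : 'I_n).

Definition replace_row G j x : 'M[R]_n :=
  \matrix_(i, k) if i == j then x 0 k else G i k.

Lemma row_replace_row G j x i :
  row i (replace_row G j x) = if i == j then x else row i G.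
Proof. by apply/rowP => k; rewrite !mxE; case: ifP; rewrite ?mxE. Qed.

Lemma det_replace_row G j x : \det (replace_row G j x) = (x *m \adj G) 0 j.
Proof.
rewrite (expand_det_row _ j) !mxE; apply: eq_bigr => k _.
rewrite !mxE eqxx; congr (_ * (_ * \det _)).
by apply/matrixP => a b; rewrite !mxE eq_sym (negbTE (neq_lift _ _)).
Qed.

Lemma det_replace_row_mul G j c : \det (replace_row G j (c *m G)) = c 0 j * \det G.
Proof. by rewrite det_replace_row -mulmxA mul_mx_adj mul_mx_scalar mxE mulrC. Qed.

End RowReplacement.

(** * The order of a determinant at u = 0 as the length of a cokernel *)

Section LatticeChain.
Variable F : closedFieldType.
Local Notation A := {poly {poly F}}.
Local Notation ev0 := (map_poly (horner_eval (0 : F))).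
Implicit Types (I : A -> Prop) (p q w h : A) (b c : F).

(** Says that I is the trace on F[u][v] of an ideal of F[u]_(u)[v]. *)
Definition saturated I :=
  forall (q : {poly F}) p, q.[0] != 0 -> I (q%:P * p) -> I p.

(** Over F[u]_(u), the rows of [G] form a basis (when det G is nonzero) of the part of I of degree
    below n in v; q is the denominator. *)
Definition lattice_of I n (G : 'M[{poly F}]_n) := forall r : 'rV_n,
  I (rVpoly r) <-> exists (q : {poly F}) (c : 'rV_n), q.[0] != 0 /\ q *: r = c *m G.

Lemma saturated_adjoin I b w : is_ideal I -> I ('X%:P * w) ->
  I (('X - b%:P%:P) * w) -> saturated I -> saturated (adjoin I w).
Proof.
move=> iI Iu Iv sI q p nq [c Ic]; exists (c / q.[0]); apply: (sI q) => //.
apply: (@ideal_sub _ _ _ (q%:P * p - c%:P%:P * w)) => //.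
have -> : q%:P * (p - (c / q.[0])%:P%:P * w) - (q%:P * p - c%:P%:P * w) =
     (c / q.[0])%:P%:P * (- (q%:P * w - (ev b q%:P)%:P%:P * w)).
  by rewrite evCp -{2}(divfK nq c) [(_ * q.[0])%:P]polyCM polyCM; ring.
by apply: idealM => //; apply: idealN => //; apply: ideal_ev.
Qed.

(* Modulo I, multiplication by v on the classes killed by u satisfies the
   polynomial f(0, v), which splits into linear factors. *)
Lemma eigenclass I f w : is_ideal I -> I f -> ev0 f != 0 -> ~ I w ->
  I ('X%:P * w) -> exists w' b, [/\ ~ I w', I ('X%:P * w') & I (('X - b%:P%:P) * w')].
Proof.
move=> iI If nf nIw Iu.
have [s sE] := closed_field_poly_normal (ev0 f).
have Is : I ((\prod_(z <- s) ('X - z%:P%:P)) * w).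
  have If0 : I ((map_poly polyC (ev0 f)) * w).
    apply: (@ideal_sub _ _ _ (f * w)) => //; last by rewrite mulrC; apply: idealM.
    suff [k kE] : exists k, map_poly polyC (ev0 f) - f = k * 'X%:P.
      by rewrite -mulrBl kE -mulrA; apply: idealM.
    elim/poly_ind: f {If nf sE} => [|f a [k IH]].
      by exists 0; rewrite !rmorph0 subrr mul0r.
    have [k' kE] := horner0_split a.
    exists (k * 'X - k'%:P); rewrite !rmorphD !rmorphM /= !map_polyX !map_polyC /=.
    rewrite {2}kE polyCD polyCM /horner_eval mulrBl mulrAC -IH; ring.
  have := idealM iI ((lead_coef (ev0 f))^-1)%:P%:P If0.
  rewrite mulrA {2}sE map_polyZ /= -mul_polyC mulrA -!polyCM mulVf ?lead_coef_eq0 //.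
  rewrite mul1r rmorph_prod /=.
  by under eq_bigr do rewrite rmorphB /= map_polyX map_polyC /=.
elim: s w nIw Iu Is {sE} => [|z s IH] w nIw Iu.
  by rewrite big_nil mul1r.
rewrite big_cons -mulrA [_ * (_ * w)]mulrCA => Is.
have [Iz|nIz] := classic (I (('X - z%:P%:P) * w)); first by exists w, z.
by apply: (IH (('X - z%:P%:P) * w)) => //; rewrite mulrCA; apply: idealM.
Qed.

(** Expand u r in the rows of G. Some coefficient c_j is a unit at u = 0, since otherwise u could be
    cancelled and r would lie in I. Exchanging row j for r therefore gives a basis of the enlarged
    lattice, and Cramer's rule compares the determinants. *)
Lemma lattice_step I n (G : 'M[{poly F}]_n) (r : 'rV_n) b : is_ideal I -> saturated I ->
  lattice_of I G -> \det G != 0 ->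
  ~ I (rVpoly r) -> I ('X%:P * rVpoly r) -> I (('X - b%:P%:P) * rVpoly r) ->
  exists (G' : 'M_n) (e : {poly F}), [/\ lattice_of (adjoin I (rVpoly r)) G',
    e.[0] != 0 & 'X * \det G' = e * \det G].
Proof.
move=> iI sI GI nG nIr Iu Iv.
have [q [c [nq qE]]] : exists (q : {poly F}) (c : 'rV_n), q.[0] != 0 /\ q *: ('X *: r) = c *m G.
  by apply/GI; rewrite linearZ /= -mul_polyC.
have [j nj] : exists j, (c 0 j).[0] != 0.
  apply/existsP; apply: contraPT nIr; rewrite negb_exists => /forallP c0; apply.
  apply/GI; exists q, (\row_k (c 0 k %/ 'X)); split=> //.
  suff XE : 'X *: (q *: r) = 'X *: ((\row_k (c 0 k %/ 'X)) *m G).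
    apply/rowP => k; have nX : 'X != 0 :> {poly F} by rewrite polyX_eq0.
    by apply: (mulfI nX); move/rowP/(_ k): XE; rewrite mxE [in X in _ = X -> _]mxE.
  rewrite scalerA mulrC -scalerA qE scalemxAl; congr (_ *m _); apply/rowP => k; rewrite !mxE.
  rewrite mulrC divpK // -['X]subr0 -polyC0 dvdp_XsubCl /root.
  by have := c0 k; rewrite negbK.
exists (replace_row G j (q *: r)), (c 0 j); split=> //; last first.
  have := det_replace_row_mul G j c; rewrite -qE => <-.
  rewrite !det_replace_row; have -> : q *: ('X *: r) = 'X *: (q *: r).
    by rewrite !scalerA mulrC.
  by rewrite -[in RHS]scalemxAl [in RHS]mxE.
set G' := replace_row _ _ _.
have iI' := ideal_adjoin iI Iu Iv.
have sI' := saturated_adjoin iI Iu Iv sI.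
have Irow i : I (rVpoly (row i G)).
  apply/GI; exists 1, (delta_mx 0 i); rewrite hornerC oner_neq0 scale1r.
  by rewrite -rowE.
move=> r'; split=> [[a]|[q2 [c2 [nq2 q2E]]]]; last first.
  apply: (sI' q2) => //; rewrite mul_polyC -linearZ /= q2E mulmx_sum_row.
  rewrite linear_sum; apply: ideal_sum => // i _; rewrite linearZ /= -mul_polyC.
  apply: idealM => //; rewrite row_replace_row; case: eqP => _.
    by rewrite linearZ /= -mul_polyC; apply: idealM => //; apply: adjoin_gen.
  exact: adjoin_sub.
rewrite mul_polyC -linearZ -linearB => /GI[q1 [c1 [nq1 q1E]]].
have rowG' i : i != j -> row i G' = row i G.
  by move=> nij; rewrite row_replace_row (negbTE nij).
have rowj : row j G' = q *: r by rewrite row_replace_row eqxx.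
have spanD x y : (exists d, x = d *m G') -> (exists d, y = d *m G') -> exists d, x + y = d *m G'.
  by move=> [d ->] [d' ->]; exists (d + d'); rewrite mulmxDl.
have spanZ (a' : {poly F}) x : (exists d, x = d *m G') -> exists d, a' *: x = d *m G'.
  by move=> [d ->]; exists (a' *: d); rewrite scalemxAl.
have spanrow i : exists d, row i G' = d *m G'.
  by exists (delta_mx 0 i); rewrite -rowE.
(* The discarded row j is recovered, up to the unit c_j, from the expansion of u r. *)
have spanG i : exists d, c 0 j *: row i G = d *m G'.
  have [->|nij] := eqVneq i j; last by apply: spanZ; rewrite -rowG'.
  have -> : c 0 j *: row j G = 'X *: row j G' + \sum_(i | i != j) (- c 0 i) *: row i G'.
    rewrite rowj scalerA mulrC -scalerA qE mulmx_sum_row (bigD1 j) //= -addrA.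
    rewrite -big_split big1 ?addr0 //= => k nk.
    by rewrite rowG' // scaleNr subrr.
  apply: (spanD _ _); first exact: spanZ.
  apply: (big_ind (fun x => exists d, x = d *m G')) => [||k _].
  - by exists 0; rewrite mul0mx.
  - exact: spanD.
  exact: spanZ.
have [d dE] : exists d, c 0 j *: (c1 *m G) = d *m G'.
  rewrite mulmx_sum_row scaler_sumr.
  apply: (big_ind (fun x => exists d, x = d *m G')) => [||k _].
  - by exists 0; rewrite mul0mx.
  - exact: spanD.
  by rewrite scalerA mulrC -scalerA; apply: spanZ.
have [d' d'E] : exists d, (q * c 0 j * q1) *: r' = d *m G'.
  have -> : (q * c 0 j * q1) *: r' = q *: (c 0 j *: (c1 *m G)) + (c 0 j * q1 * a%:P) *: row j G'.
    rewrite rowj -q1E !scalerBr !scalerA.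
    rewrite [c 0 j * q1 * a%:P * q]mulrC !mulrA subrK //.
  by apply: (spanD _ _); apply: (spanZ _ _) => //; exists d.
by exists (q * c 0 j * q1), d'; rewrite !hornerM !mulf_neq0.
Qed.

(** Each factor u of the determinant pays for one simple submodule. When none is left, G is
    invertible over F[u]_(u) and 1 lies in I. *)
Lemma lattice_chain k I n (G : 'M[{poly F}]_n) (e : {poly F}) f :
  is_ideal I -> saturated I -> I f -> ev0 f != 0 ->
  (forall p, exists r : 'rV_n, I (p - rVpoly r)) -> lattice_of I G ->
  e.[0] != 0 -> \det G = 'X^k * e -> exists bs, chain I bs /\ size bs = k.
Proof.
move=> iI sI If nf red GI ne dG.
have nX j : 'X^j != 0 :> {poly F} by rewrite expf_neq0 // polyX_eq0.
elim: k I G e iI sI If red GI ne dG => [|k IH] I G e iI sI If red GI ne dG.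
  exists [::]; split=> //; apply: chain_nil.
  have [r Ir] := red 1; apply: (ideal_sub iI Ir); apply/GI.
  exists e, (r *m \adj G); split=> //.
  by rewrite -mulmxA mul_adj_mx mul_mx_scalar dG mul1r.
have nG : \det G != 0.
  by rewrite dG mulf_neq0 //; apply: contraNneq ne => ->; rewrite horner0.
(* A left kernel vector c of G(0), with constant entries, makes c G divisible by u; w is the
   quotient. If w were in I, cancelling G would force c = 0. *)
have [w nIw Iu] : exists2 w, ~ I w & I ('X%:P * w).
  pose G0 := map_mx (horner_eval (0 : F)) G.
  have /det0P[c nc cG] : \det G0 == 0.
    by rewrite det_map_mx /= dG /horner_eval exprSr !hornerM hornerX mulr0 mul0r.
  pose c1 : 'rV_n := map_mx polyC c.
  pose r : 'rV_n := \row_j ((c1 *m G) 0 j %/ 'X).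
  have rE : 'X *: r = c1 *m G.
    apply/rowP => j; rewrite !mxE mulrC divpK // -['X]subr0 -polyC0 dvdp_XsubCl /root.
    have := congr1 (fun x : 'rV_n => x 0 j) cG; rewrite !mxE => cj; apply/eqP; rewrite -[RHS]cj.
    by rewrite horner_sum; apply: eq_bigr => i _; rewrite !mxE !hornerE.
  exists (rVpoly r).
    move=> /GI[q [c' [nq qE]]].
    have : (q *: c1 - 'X *: c') *m G = 0.
      by rewrite mulmxBl -!scalemxAl -rE -qE scalerA mulrC -scalerA subrr.
    move=> /(congr1 (mulmx^~ (\adj G))); rewrite -mulmxA mul_mx_adj mul0mx mul_mx_scalar.
    move=> dX; have cc' : q *: c1 = 'X *: c'.
      apply/rowP => j; apply/eqP; rewrite -subr_eq0; move/rowP/(_ j)/eqP: dX.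
      by rewrite !mxE mulf_eq0 (negbTE nG).
    case/eqP: nc; apply/rowP => j.
    have := congr1 (fun x : 'rV_n => (x 0 j).[0]) cc'; rewrite !mxE !hornerE => /eqP.
    by rewrite mulf_eq0 (negbTE nq) => /eqP.
  rewrite mul_polyC -linearZ /= rE; apply/GI; exists 1, c1.
  by rewrite hornerC oner_neq0 scale1r.
have [w1 [b [nIw1 Iu1 Iv1]]] := eigenclass iI If nf nIw Iu.
have [r Ir] := red w1.
have nIr : ~ I (rVpoly r) by move=> /(ideal_sub iI Ir).
have Ir' h : I (h * w1) -> I (h * rVpoly r).
  move=> Ih; have := idealB iI Ih (idealM iI h Ir).
  by rewrite -mulrBr opprB addrC subrK.
have [G' [e' [G'I ne' dG']]] := lattice_step iI sI GI nG nIr (Ir' _ Iu1) (Ir' _ Iv1).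
have [bs [cb sb]] : exists bs, chain (adjoin I (rVpoly r)) bs /\ size bs = k.
  apply: (IH _ G' (e' * e)) => //.
  - exact: ideal_adjoin (Ir' _ Iu1) (Ir' _ Iv1).
  - exact: saturated_adjoin (Ir' _ Iu1) (Ir' _ Iv1) sI.
  - exact: adjoin_sub.
  - by move=> p; have [r' Ipr] := red p; exists r'; apply: adjoin_sub.
  - by rewrite hornerM mulf_neq0.
  - by apply: (mulfI (nX 1%N)); rewrite expr1 dG' dG exprS; ring.
exists (b :: bs); split; last by rewrite /= sb.
exact: chain_cons (Ir' _ Iu1) (Ir' _ Iv1) cb.
Qed.

(** The trace on A of the ideal generated by f and g in F[u]_(u)[v]. *)
Definition ideal2 (f g : A) : A -> Prop := fun p =>
  exists (q : {poly F}) (h k : A), q.[0] != 0 /\ q%:P * p = h * f + k * g.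

Lemma is_ideal2 f g : is_ideal (ideal2 f g).
Proof.
split.
- by exists 1, 0, 0; rewrite hornerC oner_neq0 mulr0 !mul0r addr0.
- move=> p p' [q [h [k [nq qE]]]] [q' [h' [k' [nq' qE']]]].
  exists (q * q'), (q'%:P * h + q%:P * h'), (q'%:P * k + q%:P * k').
  rewrite hornerM mulf_neq0 //; split=> //.
  have -> : (q * q')%:P * (p + p') = q'%:P * (q%:P * p) + q%:P * (q'%:P * p').
    by rewrite polyCM; ring.
  by rewrite qE qE'; ring.
- move=> a p [q [h [k [nq qE]]]]; exists q, (a * h), (a * k); split=> //.
  by rewrite mulrCA qE; ring.
Qed.

(** The Sylvester rows span the ideal in degrees below deg f + deg g: as f has a constant leading
    coefficient, the cofactor of g can be reduced modulo f, and then the cofactor of f has degree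
    below deg g for degree reasons. *)
Lemma resultant_length (f g : A) (a b : F) (e : {poly F}) k :
  a != 0 -> b != 0 -> lead_coef f = a%:P -> lead_coef g = b%:P ->
  e.[0] != 0 -> resultant f g = 'X^k * e ->
  exists bs, chain (ideal2 f g) bs /\ size bs = k.
Proof.
move=> na nb lf lg ne resE.
have uf : lead_coef f \is a GRing.unit by rewrite lf poly_unitE size_polyC na coefC unitfE.
have nf : f != 0 by rewrite -lead_coef_eq0 lf polyC_eq0.
have ng : g != 0 by rewrite -lead_coef_eq0 lg polyC_eq0.
have sf : (0 < size f)%N by rewrite size_poly_gt0.
have sg : (0 < size g)%N by rewrite size_poly_gt0.
have If : ideal2 f g f by exists 1, 1, 0; rewrite hornerC oner_neq0 !mul1r mul0r addr0.
apply: (@lattice_chain k (ideal2 f g) _ (Sylvester_mx f g) e f) => //.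
- exact: is_ideal2.
- move=> q p nq [q' [h [k' [nq' qE]]]]; exists (q' * q), h, k'.
  by rewrite hornerM mulf_neq0 // polyCM -mulrA.
- rewrite -lead_coef_eq0 lead_coef_map_id0 ?lf /horner_eval ?hornerC //; exact: horner0.
- move=> p; exists (poly_rV (p %% f)); rewrite poly_rV_K; last first.
    rewrite (@leq_trans (size f).-1) ?leq_addl // -ltnS prednK //.
    exact: Pdiv.Idomain.ltn_modpN0.
  exists 1, (p %/ f), 0; rewrite hornerC oner_neq0 mul1r mul0r addr0; split=> //.
  by rewrite {1}(Pdiv.IdomainUnit.divp_eq uf p) addrK.
have szM (p q : A) m : (0 < size q)%N -> (size p <= m)%N ->
    (size (p * q)%R <= m + (size q).-1)%N.
  move=> sq sp; rewrite (leq_trans (size_polyMleq _ _)) // -(prednK sq) addnS /=.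
  by rewrite leq_add2r.
have mulS (c : 'rV_((size g).-1 + (size f).-1)) :
    c *m Sylvester_mx f g = poly_rV (rVpoly (lsubmx c) * f + rVpoly (rsubmx c) * g).
  by rewrite /Sylvester_mx -[c in LHS]hsubmxK mul_row_col !mul_rV_lin1 /= linearD.
move=> r; split=> [[q [h [k' [nq qE]]]]|[q [c [nq qE]]]].
  pose k2 : A := k' %% f; pose h2 : A := h + k' %/ f * g.
  have qE2 : q%:P * rVpoly r = h2 * f + k2 * g.
    by rewrite qE {1}(Pdiv.IdomainUnit.divp_eq uf k') /h2 /k2; ring.
  have sk2 : (size k2 <= (size f).-1)%N.
    by rewrite -ltnS prednK //; apply: Pdiv.Idomain.ltn_modpN0.
  have sh2 : (size h2 <= (size g).-1)%N.
    have [->|nh2] := eqVneq h2 0; first by rewrite size_poly0.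
    have : (size (h2 * f)%R <= (size g).-1 + (size f).-1)%N.
      have -> : h2 * f = q *: rVpoly r - k2 * g by rewrite -mul_polyC qE2 addrK.
      rewrite (leq_trans (size_polyD _ _)) // size_polyN geq_max.
      rewrite (leq_trans (size_scale_leq _ _)) ?size_poly //=.
      rewrite (leq_trans (size_polyMleq _ _)) // -(prednK sg) addnS /= addnC leq_add2l.
      exact: sk2.
    by rewrite size_mul // -(prednK sf) addnS /= leq_add2r.
  exists q, (row_mx (poly_rV h2) (poly_rV k2)); split=> //.
  rewrite mulS row_mxKl row_mxKr !poly_rV_K // -qE2 mul_polyC linearZ /=.
  by rewrite rVpolyK.
exists q, (rVpoly (lsubmx c)), (rVpoly (rsubmx c)); split=> //.
rewrite mul_polyC -linearZ /= qE mulS poly_rV_K //.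
rewrite (leq_trans (size_polyD _ _)) // geq_max.
by rewrite szM ?size_poly //= addnC szM ?size_poly.
Qed.

End LatticeChain.

(** * Ring morphisms out of polynomial rings *)

Section MpolyMorphisms.
Variables (n : nat) (R : nzRingType) (S : comNzRingType).

Lemma mpoly_rmorph_ext (f g : {rmorphism {mpoly R[n]} -> S}) :
  (forall c, f c%:MP = g c%:MP) -> (forall i, f 'X_i = g 'X_i) -> f =1 g.
Proof.
move=> eC eX p; rewrite [p]mpolyE !rmorph_sum; apply: eq_bigr => m _.
rewrite -mul_mpolyC !rmorphM eC; congr (_ * _).
rewrite mpolyXE_id !rmorph_prod; apply: eq_bigr => i _.
by rewrite !rmorphXn eX.
Qed.

Lemma homog_scale (f g : {rmorphism {mpoly R[n]} -> S}) (l : S) d p :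
  (forall c, f c%:MP = g c%:MP) -> (forall i, f 'X_i = l * g 'X_i) ->
  p \is d.-homog -> f p = l ^+ d * g p.
Proof.
move=> eC eX hp; rewrite [p]mpolyE !rmorph_sum mulr_sumr.
rewrite big_seq [RHS]big_seq; apply: eq_bigr => m /(dhomog_mf hp) /= dm.
rewrite -mul_mpolyC !rmorphM eC mulrCA; congr (_ * _).
rewrite mpolyXE_id !rmorph_prod.
under eq_bigr do rewrite rmorphXn eX exprMn -rmorphXn.
rewrite big_split /=; congr (_ * _).
by rewrite prodrXr -mdegE dm.
Qed.

Lemma msubst_exists (f : {rmorphism R -> S}) (h : 'I_n -> S) :
  {g : {rmorphism {mpoly R[n]} -> S} | (forall c, g c%:MP = f c) & (forall i, g 'X_i = h i)}.
Proof.
exists (mmap f h : {rmorphism _ -> _}) => [c|i] /=; first exact: mmapC.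
by rewrite mmapX mmap1U.
Qed.

(* Kept opaque: unfolding [mmap] makes unification try to match sums. *)
Definition msubst f h : {rmorphism {mpoly R[n]} -> S} := s2val (msubst_exists f h).

Lemma msubstC f h c : msubst f h c%:MP = f c.
Proof. by rewrite /msubst; case: msubst_exists. Qed.

Lemma msubstX f h i : msubst f h 'X_i = h i.
Proof. by rewrite /msubst; case: msubst_exists. Qed.

Lemma msubstZ f h c p : msubst f h (c *: p) = f c * msubst f h p.
Proof. by rewrite -mul_mpolyC rmorphM msubstC. Qed.

Lemma msubstE (f : {rmorphism R -> S}) h : msubst f h =1 mmap f h.
Proof.
apply: mpoly_rmorph_ext => [c|i] /=; first by rewrite msubstC mmapC.
by rewrite msubstX mmapX mmap1U.
Qed.

End MpolyMorphisms.

Lemma meval_msubst n (R : comNzRingType) (v : 'I_n -> R) p :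
  p.@[v] = msubst (@idfun R : {rmorphism R -> R}) v p.
Proof. by rewrite msubstE. Qed.

(** * Affine charts along the lines through (0:0:1) *)

Section Charts.
Variable F : fieldType.
Local Notation A := {poly {poly F}}.
Implicit Types (o : option F) (b : F) (p : {mpoly F[3]}).

(* The affine chart around the pencil of lines through (0:0:1):  the direction
   [None] is t1 = 0 with chart (u : 1 : v), the direction [Some z] is
   t2 = z t1 with chart (1 : z + u : v). *)
Definition chart1 o : {poly F} := if o is Some z then 1 else 'X.
Definition chart2 o : {poly F} := if o is Some z then 'X + z%:P else 1.
Definition chart o (i : 'I_3) : A := nth 'X [:: (chart1 o)%:P; (chart2 o)%:P; 'X] i.

(** Homogeneous coordinates of the chart point (0, b); as in [chart], the default argument of [nth]
    supplies the third coordinate. *)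
Definition pt o b (i : 'I_3) : F :=
  nth b [:: (chart1 o).[0]; (chart2 o).[0]; b] i.

Definition aff o : {rmorphism {mpoly F[3]} -> A} :=
  msubst (polyC \o polyC : {rmorphism F -> A}) (chart o).

(** [lin3 o] is the form that becomes u in the chart, and [oth3 o] the one that becomes 1, so its
    zero set is the line at infinity of the chart. *)
Definition lin3 o : {mpoly F[3]} := if o is Some z then 'X_i1 - z *: 'X_i0 else 'X_i0.
Definition oth3 o : {mpoly F[3]} := if o is Some z then 'X_i0 else 'X_i1.

Lemma affC o c : aff o c%:MP = c%:P%:P. Proof. exact: msubstC. Qed.
Lemma affX o i : aff o 'X_i = chart o i. Proof. exact: msubstX. Qed.
Lemma affZ o c p : aff o (c *: p) = c%:P%:P * aff o p. Proof. exact: msubstZ. Qed.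

Lemma aff_lin o : aff o (lin3 o) = 'X%:P.
Proof.
case: o => [z|] /=; last by rewrite affX.
rewrite rmorphB affZ !affX /chart /= polyC1 mulr1.
by rewrite rmorphD /= addrK.
Qed.

Lemma aff_oth o : aff o (oth3 o) = 1.
Proof. by case: o => [z|]; rewrite /= affX /chart /= polyC1. Qed.

Lemma homog_lin3 o : lin3 o \is 1.-homog.
Proof.
have hX i : 'X_i \is [in F[3], 1.-homog] by rewrite dhomogX /= mdeg1.
by case: o => [z|] //=; rewrite rpredB // rpredZ.
Qed.

Lemma homog_oth3 o : oth3 o \is 1.-homog.
Proof. by case: o => [z|] /=; rewrite dhomogX /= mdeg1. Qed.

Lemma ev_aff o b p : ev b (aff o p) = p.@[pt o b].
Proof.
pose e : {rmorphism A -> F} := horner_eval (0 : F) \o horner_eval b%:P.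
rewrite meval_msubst -[LHS]/((e \o aff o : {rmorphism _ -> _}) p).
apply: mpoly_rmorph_ext => [c|i] /=; first by rewrite affC msubstC /horner_eval !hornerC.
rewrite affX msubstX /chart /pt /horner_eval.
case: i => [[|[|[|//]]] hi] /=; rewrite ?hornerC ?hornerX ?hornerC //.
Qed.

(** Every large degree is offered so that several chart polynomials can be homogenized to matching
    degrees. *)
Lemma homog_lift o (q : A) : exists n0, forall n, (n0 <= n)%N ->
  exists2 p, p \is n.-homog & aff o p = q.
Proof.
elim/poly_ind: q => [|q c [n0 IH]].
  by exists 0%N => n _; exists 0; rewrite ?rpred0 ?rmorph0.
have [n1 IH1] : exists n0, forall n, (n0 <= n)%N -> exists2 p, p \is n.-homog & aff o p = c%:P.
  elim/poly_ind: c => [|c a [n1 IH1]].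
    by exists 0%N => n _; exists 0; rewrite ?rpred0 ?rmorph0.
  exists n1.+1 => -[|n] // /IH1[p hp pE]; exists (p * lin3 o + a *: oth3 o ^+ n.+1).
    rewrite rpredD //; first by rewrite -[n.+1]addn1; apply: dhomogM (homog_lin3 o).
    by rewrite rpredZ //; have := dhomogMn n.+1 (homog_oth3 o); rewrite mul1n.
  rewrite rmorphD rmorphM affZ rmorphXn pE aff_lin aff_oth expr1n mulr1.
  by rewrite -polyCM -polyCD.
exists (maxn n0 n1).+1 => -[|n] // nn; have := nn; rewrite ltnS geq_max => /andP[/IH[p hp pE] n1n].
have [|p' hp' p'E] := IH1 n.+1; first exact: leqW.
exists (p * 'X_i2 + p'); last by rewrite rmorphD rmorphM affX pE p'E.
by rewrite rpredD // -[n.+1]addn1; apply: dhomogM; rewrite // dhomogX /= mdeg1.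
Qed.

Lemma biv_subst (Q : comNzRingType) (c : {rmorphism F -> Q}) (U V : Q) :
  exists e : {rmorphism A -> Q},
    [/\ forall a, e a%:P%:P = c a, e 'X%:P = U & e 'X = V].
Proof.
pose e1 : {rmorphism {poly F} -> Q} := horner_eval U \o map_poly c.
exists (horner_eval V \o map_poly e1 : {rmorphism _ -> _}).
by split=> [a||] /=; rewrite ?map_polyC ?map_polyX /horner_eval ?hornerC ?hornerX //=
  ?map_polyC ?map_polyX /horner_eval ?hornerC ?hornerX.
Qed.

(* Homogenizing in the fraction field gives p / (oth3 o)^n back from [aff o p]. *)
Lemma aff_homog_inj o n p : p \is n.-homog -> aff o p = 0 -> p = 0.
Proof.
move=> hp p0; pose Q := {fraction {mpoly F[3]}}.
pose c : {rmorphism F -> Q} := tofrac \o (@mpolyC 3 F).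
pose den : Q := tofrac (oth3 o).
have nden : den != 0.
  rewrite tofrac_eq0; apply/eqP => o0; have := aff_oth o.
  by rewrite o0 rmorph0 => /eqP; rewrite eq_sym oner_eq0.
have [e [eC eU eV]] := biv_subst c (tofrac (lin3 o) / den) (tofrac 'X_i2 / den).
have eX i : e (chart o i) = den^-1 * tofrac 'X_i.
  rewrite /chart /den in nden eU eV *.
  case: o nden eU eV {p0 den} => [z|] /= nden eU eV; case: i => [[|[|[|//]]] hi] /=.
  - rewrite polyC1 rmorph1 (_ : Ordinal hi = i0) ?mulVf //; exact: val_inj.
  - rewrite rmorphD /= rmorphD /= eU eC tofracB (_ : Ordinal hi = i1); last exact: val_inj.
    rewrite -mul_mpolyC tofracM mulrBl mulfK // -[c z]/(tofrac z%:MP) subrK mulrC //.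
  - rewrite eV mulrC (_ : Ordinal hi = i2) //; exact: val_inj.
  - rewrite eU mulrC (_ : Ordinal hi = i0) //; exact: val_inj.
  - rewrite polyC1 rmorph1 (_ : Ordinal hi = i1) ?mulVf //; exact: val_inj.
  - rewrite eV mulrC (_ : Ordinal hi = i2) //; exact: val_inj.
have pE : (e \o aff o : {rmorphism _ -> _}) p = den^-1 ^+ n * tofrac p.
  apply: homog_scale hp => [a|i] /=; first by rewrite affC eC.
  by rewrite affX eX.
move/esym/eqP: pE; rewrite /= p0 rmorph0 mulf_eq0 expf_eq0 invr_eq0 (negbTE nden).
by rewrite andbF tofrac_eq0 => /eqP.
Qed.

End Charts.

(** * Intersection multiplicities counted by chains *)

Section IntersectionMultiplicity.
Variable F : closedFieldType.
Implicit Types (f g p : {mpoly F[3]}) (o : option F) (b : F).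

Lemma in_loc_idealP f g df dg e o b p :
  f \is df.-homog -> g \is dg.-homog -> p \is e.-homog ->
  in_loc_ideal f g (pt o b) p <-> loc (ideal2 (aff o f) (aff o g)) b (aff o p).
Proof.
move=> hf hg hp; split=> [[w [h1 [h2 [nw wE]]]]|[h [nh [q [k1 [k2 [nq qE]]]]]]].
  exists (aff o w); rewrite ev_aff; split=> //.
  exists 1, (aff o h1), (aff o h2); rewrite hornerC oner_neq0; split=> //.
  by rewrite mul1r -rmorphM wE rmorphD !rmorphM.
have [n0 L0] := homog_lift o (q%:P * h).
have [n1 L1] := homog_lift o k1.
have [n2 L2] := homog_lift o k2.
(* Large enough for the three lifts below, whose degrees are chosen so that w p, h1 f and h2 g all
   have degree N + df + dg + e; the relation then lifts by injectivity of [aff] on forms of one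
   degree. *)
pose N := (n0 + n1 + n2 + e + df + dg)%N.
have [|w hw wE] := L0 (N + df + dg)%N; first by rewrite /N -!addnA leq_addr.
have [|h1 hh1 h1E] := L1 (N + e + dg)%N.
  by rewrite (leq_trans (leq_addl n0 n1)) // /N -!addnA !leq_add2l leq_addr.
have [|h2 hh2 h2E] := L2 (N + e + df)%N.
  by rewrite (leq_trans (leq_addl (n0 + n1) n2)) // /N -!addnA !leq_add2l leq_addr.
exists w, h1, h2; split.
  by rewrite -ev_aff wE evM evCp mulf_neq0.
apply/eqP; rewrite -subr_eq0; apply/eqP; apply: (@aff_homog_inj _ o (N + df + dg + e)).
  rewrite rpredB ?rpredD //; first exact: dhomogM.
    by rewrite (_ : (N + df + dg + e = N + e + dg + df)%N); [apply: dhomogM | ring].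
  by rewrite (_ : (N + df + dg + e = N + e + df + dg)%N); [apply: dhomogM | ring].
by rewrite rmorphB rmorphD !rmorphM wE h1E h2E -mulrA qE subrr.
Qed.

Lemma aff_comb o n (c : 'I_n -> F) (ps : 'I_n -> {mpoly F[3]}) :
  aff o (\sum_(j < n) c j *: ps j) = comb c (fun j => aff o (ps j)).
Proof. by rewrite rmorph_sum /comb; apply: eq_bigr => j _; rewrite affZ. Qed.

Lemma homog_sumZ d n (c : 'I_n -> F) (ps : 'I_n -> {mpoly F[3]}) :
  (forall j, ps j \is d.-homog) -> \sum_(j < n) c j *: ps j \is d.-homog.
Proof. by move=> h; apply: rpred_sum => j _; apply: rpredZ. Qed.

Lemma imult_codim f g df dg o b bs :
  f \is df.-homog -> g \is dg.-homog -> chain (ideal2 (aff o f) (aff o g)) bs ->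
  imult_is f g (pt o b) (count_mem b bs).
Proof.
move=> hf hg ch; have iI := is_ideal2 (aff o f) (aff o g).
have [ps [ind spn]] := chain_codim b iI ch.
have iL := ideal_loc b iI; split.
  have /fin_all_exists[N HN] j : exists n0, forall n, (n0 <= n)%N ->
      exists2 p, p \is n.-homog & aff o p = ps j by apply: homog_lift.
  pose e := (\max_j N j)%N.
  have /fin_all_exists2[qs hqs qsE] j : exists2 p, p \is e.-homog & aff o p = ps j.
    by apply: HN; apply: leq_bigmax.
  exists e, qs; split=> // c [j nj] /(in_loc_idealP o b hf hg (homog_sumZ c hqs)).
  rewrite aff_comb => Lc; case/eqP: nj; apply: (ind c).
  by move: Lc; congr loc; rewrite /comb; apply: eq_bigr => i _; rewrite qsE.
move=> [e [qs [hqs nqs]]]; set n := count_mem b bs in ps ind spn qs hqs nqs.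
have /fin_all_exists[C HC] j := spn (aff o (qs j)).
(* The coordinates of n + 1 elements on n basis vectors, padded by a zero column to a square
   singular matrix; a left kernel vector is a linear relation between the elements. *)
have : \det (\matrix_(i < n.+1, k < n.+1) if unlift ord_max k is Some k' then C i k' else 0) == 0.
  rewrite (expand_det_col _ ord_max) big1 // => i _.
  by rewrite mxE unlift_none mul0r.
move=> /det0P[v nv vC].
apply: (nqs (v 0)).
  by apply/existsP; apply: contraNT nv; rewrite negb_exists => /forallP v0;
     apply/eqP/rowP => j; rewrite mxE; apply/eqP; have := v0 j; rewrite negbK.
apply/(in_loc_idealP o b hf hg (homog_sumZ (v 0) hqs)).
rewrite aff_comb /comb.
apply: (@ideal_sub _ _ _ (\sum_j (v 0 j)%:P%:P * comb (C j) ps)) => //.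
  rewrite -sumrB; apply: ideal_sum => // j _; rewrite -mulrBr; apply: idealM => //.
have -> : \sum_j (v 0 j)%:P%:P * comb (C j) ps = 0; last exact: ideal0.
rewrite /comb; under eq_bigr do rewrite mulr_sumr.
rewrite exchange_big big1 //= => k _.
have := congr1 (fun x : 'rV_n.+1 => x 0 (lift ord_max k)) vC; rewrite !mxE => vk.
under eq_bigr do rewrite mulrA -!polyCM.
rewrite -mulr_suml -!rmorph_sum /= (_ : \sum_i _ = 0) ?mul0r //.
by rewrite -[RHS]vk; apply: eq_bigr => i _; rewrite !mxE liftK.
Qed.

Lemma in_loc_ideal_sub f g f' g' a p :
  (exists c d : F, f = c *: f' + d *: g') -> (exists c d : F, g = c *: f' + d *: g') ->
  in_loc_ideal f g a p -> in_loc_ideal f' g' a p.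
Proof.
move=> [c [d ->]] [c' [d' ->]] [w [h1 [h2 [nw wE]]]].
exists w, (c *: h1 + c' *: h2), (d *: h1 + d' *: h2); split=> //.
by rewrite wE -!mul_mpolyC; ring.
Qed.

Lemma imult_is_eq f g f' g' a a' n :
  (forall p, in_loc_ideal f g a p <-> in_loc_ideal f' g' a' p) ->
  imult_is f g a n -> imult_is f' g' a' n.
Proof.
move=> E; have G m : imult_ge f g a m <-> imult_ge f' g' a' m.
  by split=> -[e [ps [hps H]]]; exists e, ps; split=> // c nc /E; apply: H.
by move=> [/G ? H]; split=> // /G.
Qed.

Lemma in_loc_ideal_pt f g a a' p :
  a =1 a' -> in_loc_ideal f g a p -> in_loc_ideal f g a' p.
Proof.
move=> aa' [w [h1 [h2 [nw wE]]]]; exists w, h1, h2; split=> //.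
by rewrite -(meval_eq _ aa').
Qed.

End IntersectionMultiplicity.

(** * Weighted homogeneity through scaling *)

Section Scaling.
Variables (n : nat) (R : comNzRingType).
Implicit Types (p : {mpoly R[n]}) (w : 'I_n -> nat).

(** Weighted homogeneity of degree d is written [wscale w p = 'X^d * p%:P]. In this form it can be
    cancelled in products and carried through determinants, since [wscale w] is a ring morphism. *)
Definition wscale w : {rmorphism {mpoly R[n]} -> {poly {mpoly R[n]}}} :=
  msubst (polyC \o mpolyC n (R := R) : {rmorphism R -> {poly {mpoly R[n]}}})
    (fun i => 'X^(w i) * ('X_i)%:P).

Lemma wscaleC w c : wscale w c%:MP = (c%:MP)%:P.
Proof. exact: msubstC. Qed.

Lemma wscaleX w i : wscale w 'X_i = 'X^(w i) * ('X_i)%:P.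
Proof. exact: msubstX. Qed.

Lemma wscaleE w p :
  wscale w p = \sum_(m <- msupp p) 'X^(\sum_i m i * w i) * (p@_m *: 'X_[m])%:P.
Proof.
rewrite {1}[p]mpolyE rmorph_sum; apply: eq_bigr => m _.
rewrite msubstZ mpolyXE_id rmorph_prod /=.
under eq_bigr do rewrite rmorphXn msubstX exprMn -exprM -rmorphXn /= mulnC.
rewrite big_split /= prodrXr -rmorph_prod /= mulrCA -mul_mpolyC polyCM.
by rewrite mulrCA.
Qed.

Lemma coef_XnC (q : {mpoly R[n]}) a b :
  ('X^a * q%:P : {poly {mpoly R[n]}})`_b = if b == a then q else 0.
Proof.
rewrite coefXnM coefC; case: ltngtP => [//|lt|->]; last by rewrite subnn.
by rewrite subn_eq0 leqNgt lt.
Qed.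

Lemma weight_of_sum (wt : 'X_{1..n} -> nat) d p :
  \sum_(m <- msupp p) 'X^(wt m) * (p@_m *: 'X_[m])%:P = 'X^d * p%:P ->
  forall m, m \in msupp p -> wt m = d.
Proof.
move=> wE m0 m0p; apply/eqP; apply: contraTT (m0p) => nd; rewrite -mcoeff_eq0; apply/eqP.
have Em m : (('X^(wt m) * (p@_m *: 'X_[m])%:P : {poly {mpoly R[n]}})`_(wt m0))@_m0 =
    if m == m0 then p@_m0 else 0.
  rewrite coef_XnC; have [->|nm] := eqVneq m m0.
    by rewrite eqxx mcoeffZ mcoeffX (eqxx m0) mulr1.
  by case: (wt m0 == wt m); rewrite ?mcoeff0 // mcoeffZ mcoeffX (negbTE nm) mulr0.
transitivity (\sum_(m <- msupp p) if m == m0 then p@_m0 else 0).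
  by rewrite -big_mkcond -big_filter filter_pred1_uniq ?msupp_uniq // big_seq1.
have /(congr1 (mcoeff m0)) := congr1 (fun q : {poly {mpoly R[n]}} => q`_(wt m0)) wE.
rewrite coef_XnC (negbTE nd) mcoeff0 coef_sum raddf_sum /= => E.
by rewrite -[RHS]E; apply: eq_bigr => m _; rewrite Em.
Qed.

Lemma weight_of_wscale w d p : wscale w p = 'X^d * p%:P ->
  forall m, m \in msupp p -> (\sum_i m i * w i)%N = d.
Proof.
rewrite wscaleE.
exact: (@weight_of_sum (fun m : 'X_{1..n} => \sum_i m i * w i)%N).
Qed.

End Scaling.
Arguments wscale {n R} w.

(** * Congruences between ring morphisms, and divisibility *)

Section Congruence.
Variables (n : nat) (R : nzRingType) (S : comNzRingType).

Lemma rdvdD (d p q : S) : rdvd d p -> rdvd d q -> rdvd d (p + q).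
Proof. by move=> [a ->] [b ->]; exists (a + b); rewrite mulrDl. Qed.

Lemma rdvdMl (d p q : S) : rdvd d p -> rdvd d (q * p).
Proof. by move=> [a ->]; exists (q * a); rewrite mulrA. Qed.

Lemma mpoly_rmorph_congr (f g : {rmorphism {mpoly R[n]} -> S}) (d : S) p :
  (forall c, f c%:MP = g c%:MP) -> (forall i, rdvd d (f 'X_i - g 'X_i)) ->
  rdvd d (f p - g p).
Proof.
move=> eC eX.
have e0 : rdvd d (0 : S) by exists 0; rewrite mul0r.
have cM x y x' y' : rdvd d (x - x') -> rdvd d (y - y') -> rdvd d (x * y - x' * y').
  move=> dx dy; rewrite (_ : _ - _ = y * (x - x') + x' * (y - y')); last by ring.
  by apply: rdvdD; apply: rdvdMl.
rewrite [p]mpolyE !rmorph_sum -sumrB.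
apply: (big_ind (rdvd d)) => // [|m _]; first exact: rdvdD.
rewrite -mul_mpolyC !rmorphM eC; apply: (cM _ _ _ _); first by rewrite subrr.
rewrite mpolyXE_id !rmorph_prod.
apply: (big_ind2 (fun x y => rdvd d (x - y))) => [|x1 x2 y1 y2|i _]; first by rewrite subrr.
- exact: (cM _ _ _ _).
rewrite !rmorphXn; elim: (m i) => [|k IH]; first by rewrite !expr0 subrr.
by rewrite !exprS; apply: (cM _ _ _ _).
Qed.

End Congruence.

(* In particular d is prime, its quotient ring embedding into a domain. *)
Lemma rdvd_retract n (K : fieldType) (d p : {mpoly K[n]})
    (f : {rmorphism {mpoly K[n]} -> {mpoly K[n]}}) :
  (forall c, f c%:MP = c%:MP) -> (forall i, rdvd d ('X_i - f 'X_i)) -> f d = 0 ->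
  rdvd d p <-> f p = 0.
Proof.
move=> fC fX fd; split=> [[q ->]|fp]; first by rewrite rmorphM fd mulr0.
rewrite -[p]subr0 -fp.
exact: (@mpoly_rmorph_congr _ _ _ (idfun : {rmorphism _ -> _}) f).
Qed.

(** * Binary forms and their common linear factors *)

Section Content.
Variable K : closedFieldType.
Local Notation B := {mpoly K[2]}.
Implicit Types (o : option K) (p d q : B) (D : seq (option K)).
Local Notation j0 := (ord0 : 'I_2).
Local Notation j1 := (ord_max : 'I_2).

Lemma ord2P (P : 'I_2 -> Prop) : P j0 -> P j1 -> forall i, P i.
Proof.
move=> h0 h1 [[|[|//]] hi]; first by rewrite (_ : Ordinal hi = j0) //; apply: val_inj.
by rewrite (_ : Ordinal hi = j1) //; apply: val_inj.
Qed.

Definition lin2 o : B := if o is Some z then 'X_j1 - z *: 'X_j0 else 'X_j0.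
Definition oth2 o : B := if o is Some z then 'X_j0 else 'X_j1.
Definition dir o (i : 'I_2) : K :=
  if o is Some z then (if i == j0 then 1 else z) else (if i == j0 then 0 else 1).

(** Restriction to the line spanned by [dir o], with coordinate [oth2 o]; its kernel is the ideal of
    [lin2 o], which is thereby prime. *)
Definition retr o : {rmorphism B -> B} :=
  msubst (mpolyC 2 (R := K) : {rmorphism K -> B}) (fun i => dir o i *: oth2 o).

Lemma retrC o c : retr o c%:MP = c%:MP. Proof. exact: msubstC. Qed.
Lemma retrX o i : retr o 'X_i = dir o i *: oth2 o. Proof. exact: msubstX. Qed.

Lemma homog_X2 i : 'X_i \is [in K[2], 1.-homog].
Proof. by rewrite dhomogX /= mdeg1. Qed.

Lemma homog_lin2 o : lin2 o \is 1.-homog.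
Proof. by case: o => [z|] /=; rewrite ?rpredB ?rpredZ ?homog_X2. Qed.

Lemma lin2_neq0 o : lin2 o != 0.
Proof.
apply/eqP => /(congr1 (meval (dir (if o is Some z then None else Some 0)))).
by case: o => [z|]; rewrite /= ?mevalB ?mevalZ !mevalXU meval0 /dir /= ?mulr0 ?subr0 => /eqP;
  rewrite oner_eq0.
Qed.

Lemma rdvd_lin2 o p : rdvd (lin2 o) p <-> retr o p = 0.
Proof.
apply: rdvd_retract => [c||]; first exact: retrC.
  apply: ord2P; rewrite retrX; case: o => [z|] /=.
  - by exists 0; rewrite scale1r subrr mul0r.
  - by exists 1; rewrite scale0r subr0 mul1r.
  - by exists 1; rewrite mul1r.
  - by exists 0; rewrite scale1r subrr mul0r.
case: o => [z|] /=; last by rewrite retrX scale0r.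
by rewrite rmorphB -mul_mpolyC rmorphM retrC !retrX /= scale1r mul_mpolyC subrr.
Qed.

Lemma lin2_prime o p q : rdvd (lin2 o) (p * q) -> rdvd (lin2 o) p \/ rdvd (lin2 o) q.
Proof.
move=> /rdvd_lin2; rewrite rmorphM => /eqP; rewrite mulf_eq0.
by move=> /orP[] /eqP h; [left|right]; apply/rdvd_lin2.
Qed.

Lemma lin2_root o N p : p \is N.-homog -> p.@[dir o] = 0 -> rdvd (lin2 o) p.
Proof.
move=> hp p0; apply/rdvd_lin2.
pose g : {rmorphism B -> B} := mpolyC 2 (R := K) \o meval (dir o).
rewrite (@homog_scale _ _ _ _ g (oth2 o) N) //.
- by rewrite /= p0 mpolyC0 mulr0.
- by move=> c; rewrite retrC /= mevalC.
- by move=> i; rewrite retrX /= mevalXU mulrC mul_mpolyC.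
Qed.

Lemma lin2_dir o : (lin2 o).@[dir o] = 0.
Proof.
case: o => [z|] /=; rewrite ?mevalB ?mevalZ !mevalXU /dir //=.
by rewrite mulr1 subrr.
Qed.

Lemma rdvd_root o p : rdvd (lin2 o) p -> p.@[dir o] = 0.
Proof. by move=> [q ->]; rewrite mevalM lin2_dir mulr0. Qed.

Lemma homog_wscale N p : p \is N.-homog -> wscale (fun=> 1%N) p = 'X^N * p%:P.
Proof.
apply: (@homog_scale _ _ _ _ (polyC : {rmorphism B -> {poly B}})) => [c|i].
  by rewrite wscaleC.
by rewrite wscaleX expr1.
Qed.

Lemma homog_quo o N q : q * lin2 o \is N.+1.-homog -> q \is N.-homog.
Proof.
move=> /homog_wscale; rewrite rmorphM (homog_wscale (homog_lin2 o)) expr1 => E.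
apply/dhomogP => m /=; rewrite mdegE.
under eq_bigr do rewrite -[m _]muln1.
apply: weight_of_wscale; apply: (@mulIf _ ('X * (lin2 o)%:P)).
  by rewrite mulf_neq0 ?polyX_eq0 // polyC_eq0 lin2_neq0.
by rewrite E exprSr polyCM; ring.
Qed.

Lemma homog_dehom_inj N p : p \is N.-homog ->
  msubst (polyC : {rmorphism K -> {poly K}}) (fun i => if i == j0 then 1 else 'X) p = 0 ->
  p = 0.
Proof.
move=> hp; set e := msubst _ _ => p0; pose Q := {fraction B}.
pose c : {rmorphism K -> Q} := tofrac \o mpolyC 2 (R := K).
have nX : tofrac 'X_j0 != 0 :> Q by rewrite tofrac_eq0; apply: (lin2_neq0 None).
pose h : {rmorphism {poly K} -> Q} := horner_eval (tofrac 'X_j1 / tofrac 'X_j0) \o map_poly c.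
have /esym/eqP : (h \o e : {rmorphism _ -> _}) p = (tofrac 'X_j0)^-1 ^+ N * tofrac p.
  apply: homog_scale hp => [a|] /=.
    by rewrite /e msubstC map_polyC /horner_eval hornerC.
  apply: ord2P; rewrite /e msubstX /=; first by rewrite rmorph1 /horner_eval hornerC mulVf.
  by rewrite map_polyX /horner_eval hornerX mulrC.
rewrite /= p0 !rmorph0 mulf_eq0 expf_eq0 invr_eq0 (negbTE nX) andbF tofrac_eq0.
by move/eqP.
Qed.

Lemma homog_factor N p : p \is N.+1.-homog -> exists o, p.@[dir o] = 0.
Proof.
move=> hp; have [p0|p0] := eqVneq p.@[dir None] 0; first by exists None.
pose e := msubst (polyC : {rmorphism K -> {poly K}}) (fun i : 'I_2 => if i == j0 then 1 else 'X).
have eE z : (e p).[z] = p.@[dir (Some z)].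
  rewrite -[LHS]/((horner_eval z \o e : {rmorphism _ -> _}) p).
  rewrite -[RHS]/((meval (dir (Some z)) : {rmorphism _ -> _}) p).
  apply: mpoly_rmorph_ext => [c|] /=; first by rewrite mevalC /e msubstC /horner_eval hornerC.
  by apply: ord2P; rewrite mevalXU /e msubstX /horner_eval /dir /= ?hornerC ?hornerX.
have [/closed_rootP[z /rootP ez]|] := boolP (size (e p) != 1%N).
  by exists (Some z); rewrite -eE.
(* If p(1, T) is a constant c, then p = c t1^(N+1), which vanishes in the direction [None] after
   all. *)
rewrite negbK => /size_poly1P[c nc ec]; case/eqP: p0.
suff -> : p = c *: 'X_j0 ^+ N.+1 by rewrite mevalZ (rmorphXn (meval _)) /= mevalXU /dir /= expr0n mulr0.
apply/eqP; rewrite -subr_eq0; apply/eqP; apply: (@homog_dehom_inj N.+1).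
  by rewrite rpredB // rpredZ //; have := dhomogMn N.+1 (homog_X2 j0); rewrite mul1n.
have e0 : e 'X_j0 = 1 by rewrite /e msubstX.
have eC : e c%:MP = c%:P by rewrite /e msubstC.
by rewrite -/e -mul_mpolyC rmorphB rmorphM rmorphXn e0 eC ec expr1n mulr1 subrr.
Qed.

(** A linear factor of p is prime: it divides d, or it divides k and can be cancelled, lowering the
    degree of p. *)
Lemma homog_divisor N p k d : p \is N.-homog -> p != 0 -> p = k * d ->
  rdvd d 1 \/ exists o, rdvd (lin2 o) d.
Proof.
elim: N p k => [|N IH] p k hp np pE.
  have : msize p = 1%N.
    have := dhomog_uniq np hp (dhomog_msize hp); have := msize_poly_eq0 p.
    by rewrite (negbTE np); case: (msize p) => [//|[|]].
  have nk : k != 0 by apply: contraNneq np => k0; rewrite pE k0 mul0r.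
  have nd : d != 0 by apply: contraNneq np => d0; rewrite pE d0 mulr0.
  rewrite pE msizeM // => sz; left.
  have /eqP/msize_poly1P[c nc ->] : msize d = 1%N.
    move: sz; have := msize_poly_eq0 k; have := msize_poly_eq0 d.
    rewrite (negbTE nk) (negbTE nd).
    by case: (msize k) => [//|a]; case: (msize d) => [//|b] _ _; rewrite addSn addnS /= => -[/eqP]; rewrite addn_eq0 => /andP[_ /eqP->].
  by exists (c^-1)%:MP; rewrite -mpolyCM mulVf.
have [o /(lin2_root hp)[p' p'E]] := homog_factor hp.
have hp' : p' \is N.-homog by apply: (@homog_quo o); rewrite -p'E.
have np' : p' != 0 by apply: contraNneq np => p0; rewrite p'E p0 mul0r.
have /lin2_prime[[k' k'E]|] : rdvd (lin2 o) (k * d) by exists p'; rewrite -pE.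
  apply: (IH p' k') => //; apply: (mulIf (lin2_neq0 o)).
  by rewrite -p'E pE k'E; ring.
by right; exists o.
Qed.

Definition lins D : B := \prod_(o <- D) lin2 o.

Lemma deg_lins D : deg_t (lins D) = size D.
Proof.
have nD : lins D != 0.
  by rewrite /lins; elim: D => [|o D IH]; rewrite ?big_nil ?oner_neq0 // big_cons mulf_neq0 ?lin2_neq0.
have hD : lins D \is (size D).-homog.
  rewrite /lins; elim: D {nD} => [|o D IH]; rewrite ?big_nil ?dhomog1 // big_cons /=.
  by rewrite -(add1n (size D)); apply: dhomogM => //; apply: homog_lin2.
by have := dhomog_uniq nD hD (dhomog_msize hD).
Qed.

Lemma mpoly_coef_quo (P : {mpoly B[3]}) d : (forall mu, rdvd d P@_mu) ->
  exists P', P = d *: P'.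
Proof.
move=> dP; have dP' mu : exists q, P@_mu == q * d.
  by have [q ->] := dP mu; exists q.
exists (\sum_(mu <- msupp P) xchoose (dP' mu) *: 'X_[mu]).
rewrite scaler_sumr [LHS]mpolyE; apply: eq_bigr => mu _.
by rewrite scalerA mulrC -(eqP (xchooseP (dP' mu))).
Qed.

(** A common divisor that is not a unit divides a nonzero form, so it has a linear factor, whose
    root is a common zero of all coefficients. *)
Lemma content_trivial N (P : {mpoly B[3]}) :
  P != 0 -> (forall mu, P@_mu \is N.-homog) ->
  ~ (exists o, forall mu, (P@_mu).@[dir o] = 0) ->
  (forall o, exists mu, (P@_mu).@[dir o] != 0) /\
  forall d, (forall mu, rdvd d P@_mu) -> rdvd d 1.
Proof.
move=> nP hP no; split=> [o|d dP].
  apply: NNPP => nmu; apply: no; exists o => mu; apply/eqP/negPn/negP => nz.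
  by apply: nmu; exists mu.
have [mu nz] : exists mu, P@_mu != 0.
  apply: NNPP => nmu; case/eqP: nP; apply/mpolyP => mu; rewrite mcoeff0.
  by apply/eqP/negPn/negP => nz; apply: nmu; exists mu.
have [k kE] := dP mu; case: (homog_divisor (hP mu) nz kE) => // -[o [q qE]].
case: no; exists o => nu; apply: rdvd_root; have [l ->] := dP nu.
by exists (l * q); rewrite qE mulrA.
Qed.

(** Common linear factors are removed one by one, each lowering N. A common divisor of P either
    contains the factor removed, which is cancelled, or by primality already divides the
    quotient. *)
Lemma content_decomp N (P : {mpoly B[3]}) :
  P != 0 -> (forall mu, P@_mu \is N.-homog) ->
  exists D P', [/\ P = lins D *: P', forall o, exists mu, (P'@_mu).@[dir o] != 0 &
    forall d, (forall mu, rdvd d P@_mu) -> rdvd d (lins D)].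
Proof.
elim: N P => [|N IH] P nP hP.
all: have [[o o0]|no] := classic (exists o, forall mu, (P@_mu).@[dir o] = 0); last first.
1,3: by exists [::], P; have [] := content_trivial nP hP no; rewrite /lins big_nil scale1r.
  case/eqP: nP; apply/mpolyP => mu; rewrite mcoeff0.
  have [//|nz] := eqVneq P@_mu 0.
  have /msize1_polyC E : (msize P@_mu <= 1)%N.
    have := dhomog_uniq nz (hP mu) (dhomog_msize (hP mu)).
    by case: (msize _) => [//|[]].
  by have := o0 mu; rewrite E mevalC => ->; rewrite mpolyC0.
have [P1 P1E] : exists P1, P = lin2 o *: P1.
  by apply: mpoly_coef_quo => mu; apply: lin2_root (hP mu) (o0 mu).
have nP1 : P1 != 0 by apply: contraNneq nP => p0; rewrite P1E p0 scaler0.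
have hP1 mu : P1@_mu \is N.-homog.
  by apply: (@homog_quo o); have := hP mu; rewrite P1E mcoeffZ mulrC.
have [D [P' [P'E nd gD]]] := IH P1 nP1 hP1.
exists (o :: D), P'; split=> //.
  by rewrite P1E P'E scalerA /lins big_cons.
move=> d dP; rewrite /lins big_cons.
have [[d' d'E]|ndo] := classic (rdvd (lin2 o) d).
  have [|q qE] := gD d' => [mu|].
    have [q qE] := dP mu; exists q; apply: (mulIf (lin2_neq0 o)).
    by move: qE; rewrite P1E mcoeffZ d'E mulrC => ->; rewrite mulrA.
  by exists q; rewrite -/(lins D) qE d'E; ring.
apply: rdvdMl; apply: gD => mu; have [q qE] := dP mu.
have /lin2_prime[[q' q'E]|//] : rdvd (lin2 o) (q * d).
  by exists (P1@_mu); rewrite -qE P1E mcoeffZ mulrC.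
exists q'; apply: (mulIf (lin2_neq0 o)).
by move: qE; rewrite P1E mcoeffZ q'E mulrC => ->; ring.
Qed.

End Content.

Lemma split_lshift m n (i : 'I_m) : split (lshift n i) = inl i.
Proof. exact: (unsplitK (inl i)). Qed.

Lemma split_rshift m n (i : 'I_n) : split (rshift m i) = inr i.
Proof. exact: (unsplitK (inr i)). Qed.

Lemma resultant_map (R S : nzRingType) (f : {rmorphism R -> S}) (p q : {poly R}) :
  f (lead_coef p) != 0 -> f (lead_coef q) != 0 ->
  f (resultant p q) = resultant (map_poly f p) (map_poly f q).
Proof.
move=> np nq; have sp := size_map_poly_id0 np; have sq := size_map_poly_id0 nq.
rewrite /resultant /Sylvester_mx sp sq -det_map_mx; congr (\det _).
apply/matrixP => i j; rewrite !mxE; case: (split i) => k;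
  by rewrite !mxE /= !rVpoly_delta !coefXnM coef_map; case: ifP; rewrite ?rmorph0.
Qed.

(** * Homogeneity of the resultant *)

Section ResultantWeight.
Variables (n : nat) (R : idomainType) (w : 'I_n -> nat).
Local Notation P := {mpoly R[n]}.

(** The coefficient of degree k has weight d - k, stated without subtraction. *)
Definition graded (d : nat) (p : {poly P}) :=
  forall k, 'X^k * wscale w p`_k = 'X^d * (p`_k)%:P.

(** Multiplying column j of the rescaled Sylvester matrix by T^j makes each row a power of T times
    the original row. The exponents of the rows exceed those of the columns by dp dq in total. *)
Lemma wscale_resultant (p q : {poly P}) dp dq :
  size p = dp.+1 -> size q = dq.+1 -> graded dp p -> graded dq q ->
  wscale w (resultant p q) = 'X^(dq * dp) * (resultant p q)%:P.
Proof.
move=> /(congr1 predn) /= <- /(congr1 predn) /= <-.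
clear dp dq; set dp := (size p).-1; set dq := (size q).-1 => gp gq.
have [S [SdE SE]] : exists S : 'M[P]_(dq + dp), \det S = resultant p q /\
    forall i j, S i j = match split i with
      inl k => p`_(j - k) *+ (k <= j) | inr k => q`_(j - k) *+ (k <= j) end.
  by exists (Sylvester_mx p q); split=> // i j; rewrite Sylvester_mxE.
pose rw (i : 'I_(dq + dp)) := match split i with inl k => (dp + k)%N | inr k => (dq + k)%N end.
have ES : map_mx (wscale w) S *m diag_mx (\row_j 'X^j) =
    diag_mx (\row_i 'X^(rw i)) *m map_mx polyC S.
  rewrite mul_mx_diag mul_diag_mx; apply/matrixP => i j; rewrite !mxE SE /rw.
  have gE (r : {poly P}) e k : graded e r ->
      wscale w (r`_(j - k) *+ (k <= j)) * 'X^j = 'X^(e + k) * (r`_(j - k) *+ (k <= j))%:P.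
    move=> gr; have [kj|_] := leqP k j; last by rewrite !mulr0n !rmorph0 mul0r mulr0.
    rewrite !mulr1n mulrC -{1}(subnKC kj) exprD -mulrA gr exprD; ring.
  by case: (split i) => k; apply: gE.
have := congr1 determinant ES.
rewrite !det_mulmx !det_diag !det_map_mx SdE.
under eq_bigr do rewrite mxE.
under [in RHS]eq_bigr do rewrite mxE.
rewrite !prodrXr => E.
have aE : (\sum_(i < dq + dp) rw i = dq * dp + \sum_(j < dq + dp) j)%N.
  rewrite !big_split_ord /= /rw.
  under eq_bigr do rewrite split_lshift.
  under [X in (_ + X)%N]eq_bigr do rewrite split_rshift.
  rewrite !big_split /= !sum_nat_const !card_ord; ring.
move: E; rewrite aE exprD mulrAC => /mulIf -> //.
by rewrite expf_neq0 // polyX_eq0.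
Qed.

End ResultantWeight.

(** * Coefficients with respect to x and to t3 *)

Section CoeffX.
Variable K : fieldType.
Local Notation B := {mpoly K[2]}.
Local Notation K5 := {mpoly K[5]}.

Definition tpart (m : 'X_{1..5}) : 'X_{1..2} := [multinom m (tvar j) | j < 2].
Definition xpart (m : 'X_{1..5}) : 'X_{1..3} := [multinom m (xvar j) | j < 3].

Definition toX : {rmorphism K5 -> {mpoly B[3]}} :=
  msubst (mpolyC 3 (R := B) \o mpolyC 2 (R := K) : {rmorphism K -> {mpoly B[3]}})
    (fun i : 'I_5 => match split (i : 'I_(2 + 3)) with inl j => ('X_j)%:MP | inr j => 'X_j end).

Lemma ord5P (Q : 'I_5 -> Prop) : (forall j, Q (tvar j)) -> (forall j, Q (xvar j)) -> forall i, Q i.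
Proof. by move=> Qt Qx i; rewrite -[i](@splitK 2 3); case: (split _) => j /=. Qed.

Lemma toXZ c R : toX (c *: R) = (c%:MP)%:MP * toX R.
Proof. exact: msubstZ. Qed.

Lemma toXt j : toX 'X_(tvar j) = ('X_j)%:MP.
Proof. by rewrite /toX msubstX (@split_lshift 2 3). Qed.

Lemma toXx j : toX 'X_(xvar j) = 'X_j.
Proof. by rewrite /toX msubstX (@split_rshift 2 3). Qed.

Lemma toX_mono m : toX 'X_[m] = ('X_[tpart m])%:MP * 'X_[xpart m].
Proof.
rewrite (mpolyXE_id _ m) (mpolyXE_id _ (tpart m)) (mpolyXE_id _ (xpart m)).
rewrite (@big_split_ord _ _ _ 2 3) rmorphM !(rmorph_prod toX).
rewrite (rmorph_prod (mpolyC 3 (R := B))); congr (_ * _); apply: eq_bigr => j _; rewrite mnmE.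
  by rewrite [LHS]rmorphXn [RHS]rmorphXn toXt.
by rewrite [LHS]rmorphXn toXx.
Qed.

Lemma mcoeff_toX R mu : (toX R)@_mu = coeff_x R mu.
Proof.
rewrite {1}[R]mpolyE rmorph_sum raddf_sum /coeff_x [RHS]big_mkcond; apply: eq_bigr => m _.
rewrite toXZ toX_mono /= !mcoeffCM mcoeffX -/(xpart m) -/(tpart m).
by case: eqP => _; rewrite ?mulr1 ?mulr0 // mul_mpolyC.
Qed.

Lemma toX_neq0 R : R != 0 -> toX R != 0.
Proof.
pose c : {rmorphism B -> K5} := msubst (mpolyC 5 (R := K) : {rmorphism K -> K5}) (fun j => 'X_(tvar j)).
pose back : {rmorphism {mpoly B[3]} -> K5} := msubst c (fun j => 'X_(xvar j)).
suff E : back (toX R) = R by apply: contraNneq => R0; rewrite -E R0 rmorph0.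
rewrite -[LHS]/((back \o toX : {rmorphism _ -> _}) R).
rewrite -[RHS]/((idfun : {rmorphism _ -> _}) R); apply: mpoly_rmorph_ext => [a|] /=.
  by rewrite /toX msubstC /= /back msubstC /c msubstC.
apply: ord5P => j; first by rewrite toXt /back msubstC /c msubstX.
by rewrite toXx /back msubstX.
Qed.

Definition tweight (i : 'I_5) : nat := if split (i : 'I_(2 + 3)) is inl _ then 1%N else 0%N.

Lemma homog_coeff_x N (R : K5) mu : wscale tweight R = 'X^N * R%:P -> coeff_x R mu \is N.-homog.
Proof.
move=> /weight_of_wscale wR; rewrite /coeff_x big_seq_cond.
apply: rpred_sum => m /andP[/wR wm _]; rewrite rpredZ // dhomogX /= mdegE -wm.
rewrite (@big_split_ord _ _ _ 2 3) /= [X in (_ + X)%N]big1 ?addn0 => [|j _]; last first.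
  by rewrite /tweight (@split_rshift 2 3) muln0.
by apply/eqP/eq_bigr => j _; rewrite /tweight (@split_lshift 2 3) muln1 mnmE.
Qed.

Definition t3m : {rmorphism {mpoly K[3]} -> {poly K5}} :=
  msubst (polyC \o mpolyC 5 (R := K) : {rmorphism K -> {poly K5}})
   (fun i : 'I_3 => nth 'X [:: ('X_(tvar ord0))%:P; ('X_(tvar ord_max))%:P; 'X] i).

Lemma to_t3polyE p : to_t3poly p = t3m p.
Proof. by rewrite /t3m msubstE. Qed.

Lemma t3mZ c p : t3m (c *: p) = (c%:MP)%:P * t3m p.
Proof. exact: msubstZ. Qed.

Lemma t3mX i :
  t3m 'X_i = nth 'X [:: ('X_(tvar ord0))%:P; ('X_(tvar ord_max))%:P; 'X] i.
Proof. exact: msubstX. Qed.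

Lemma t3m_coef p k : (t3m p)`_k = \sum_(m <- msupp p | m i2 == k)
  p@_m *: ('X_(tvar ord0) ^+ m i0 * 'X_(tvar ord_max) ^+ m i1).
Proof.
rewrite {1}[p]mpolyE rmorph_sum coef_sum [RHS]big_mkcond; apply: eq_bigr => m _.
rewrite t3mZ mpolyXE_id rmorph_prod !big_ord_recl big_ord0 mulr1.
rewrite !rmorphXn !t3mX /= -!rmorphXn /= !mulrA -!polyCM coefCM coefXn.
have -> : lift ord0 (lift ord0 ord0) = i2 by apply: val_inj.
rewrite eq_sym; case: eqP => _; rewrite ?mulr0 // mulr1.
by rewrite -mul_mpolyC mulrA.
Qed.

Lemma mdeg3 (m : 'X_{1..3}) : mdeg m = (m i0 + m i1 + m i2)%N.
Proof.
rewrite mdegE !big_ord_recl big_ord0 addn0 addnA; congr (_ + m _)%N; exact: val_inj.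
Qed.

Lemma t3m_size d p : p \is d.-homog -> (size (t3m p) <= d.+1)%N.
Proof.
move=> hp; apply/leq_sizeP => k dk; rewrite t3m_coef big_seq_cond big1 // => m /andP[mp /eqP mk].
by have := dhomog_mf hp mp; rewrite /= mdeg3 mk => E; move: dk; rewrite -E ltnNge leq_addl.
Qed.

Lemma t3m_lead d p : p \is d.-homog -> (t3m p)`_d = (p.@[e3 K])%:MP.
Proof.
move=> hp; rewrite t3m_coef mevalE rmorph_sum [LHS]big_mkcond big_seq [RHS]big_seq.
apply: eq_bigr => m mp; have := dhomog_mf hp mp; rewrite /= mdeg3 => md.
rewrite !big_ord_recl big_ord0 /e3 /= expr1n !mulr1.
case: eqP => m2.
  have [m0 m1] : m i0 = 0%N /\ m i1 = 0%N.
    by move: md; rewrite m2 => /(congr1 (subn^~ d)); rewrite addnK subnn => /eqP; rewrite addn_eq0 => /andP[/eqP ? /eqP ?].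
  by rewrite -[m ord0]/(m i0) -[m (lift ord0 ord0)]/(m i1) m0 m1 !expr0 !mulr1 -mul_mpolyC mulr1.
suff : (0 ^+ m i0 * 0 ^+ m i1 : K) = 0 by rewrite /i0 /i1 => ->; rewrite mulr0 mpolyC0.
rewrite !expr0n; case: eqP => m0; rewrite ?mul0r //; case: eqP => m1; rewrite ?mulr0 //.
by case: m2; rewrite -md m0 m1.
Qed.

Lemma monomial_scale (S : comNzRingType) (l c x y : S) a b k :
  l ^+ k * (c * ((l * x) ^+ a * (l * y) ^+ b)) = l ^+ (a + b + k) * (c * (x ^+ a * y ^+ b)).
Proof. by rewrite !exprMn !exprD; ring. Qed.

Lemma graded_t3m d p : p \is d.-homog -> graded tweight d (t3m p).
Proof.
move=> hp k; rewrite t3m_coef !rmorph_sum !mulr_sumr big_seq_cond [RHS]big_seq_cond.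
apply: eq_bigr => m /andP[mp /eqP mk]; have := dhomog_mf hp mp; rewrite /= mdeg3 mk => <-.
have wt j : wscale tweight ('X_(tvar j) : K5) = 'X * ('X_(tvar j))%:P.
  by rewrite wscaleX /tweight (@split_lshift 2 3) expr1.
rewrite -mul_mpolyC !rmorphM !rmorphXn !wt wscaleC.
exact: monomial_scale.
Qed.

Lemma graded_xB d (j k : 'I_3) (p q : {poly K5}) :
  graded tweight d p -> graded tweight d q ->
  graded tweight d (('X_(xvar j))%:P * p - ('X_(xvar k))%:P * q).
Proof.
move=> gp gq i; rewrite coefB !coefCM !rmorphB !rmorphM !mulrBr.
have wx l : wscale tweight 'X_(xvar l) = ('X_(xvar l) : K5)%:P.
  by rewrite wscaleX /tweight (@split_rshift 2 3) expr0 mul1r.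
by rewrite !wx; congr (_ - _); rewrite mulrCA ?gp ?gq mulrCA.
Qed.

End CoeffX.
Arguments toX {K}.
Arguments t3m {K}.

(** * A homogeneous relation between three univariate polynomials *)

Section LinearDependence.
Variable K : fieldType.

Lemma poly_lin_dep (T : finType) (g : T -> {poly K}) m :
  (forall t, (size (g t) <= m)%N) -> (m < #|T|)%N ->
  exists c : T -> K, (exists t, c t != 0) /\ \sum_t c t *: g t = 0.
Proof.
move=> sg mT; pose C : 'M[K]_(#|T|, m) := \matrix_i poly_rV (g (enum_val i)).
have /rowV0Pn[v /sub_kermxP vC nv] : kermx C != 0.
  by rewrite -mxrank_eq0 mxrank_ker -lt0n subn_gt0 (leq_ltn_trans (rank_leq_col C)).
exists (fun t => v 0 (enum_rank t)); split.
  have [i ni] : exists i, v 0 i != 0.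
    by apply/existsP; apply: contraNT nv; rewrite negb_exists => /forallP v0;
      apply/eqP/rowP => i; rewrite mxE; apply/eqP; have := v0 i; rewrite negbK.
  by exists (enum_val i); rewrite enum_valK.
have := congr1 rVpoly vC; rewrite mulmx_sum_row linear_sum linear0 => E.
rewrite -[RHS]E (reindex (@enum_val T T)) /=; last first.
  by apply: onW_bij; apply: enum_val_bij.
apply: eq_bigr => i _; rewrite linearZ /= enum_valK rowK poly_rV_K //.
Qed.

(* With p of size at most d, the (2d+2)^2 monomials of degree 2(2d+1) whose first
   two exponents are at most 2d+1 outnumber the coefficients of their values. *)
Lemma poly3_relation (p : 'I_3 -> {poly K}) : exists (G : {mpoly K[3]}) e,
  [/\ G != 0, G \is e.-homog & msubst (polyC : {rmorphism K -> {poly K}}) p G = 0].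
Proof.
pose d := (\max_i size (p i))%N; pose N := (2 * d + 1)%N; pose e := (2 * N)%N.
pose T := ('I_N.+1 * 'I_N.+1)%type.
pose mon (t : T) : 'X_{1..3} := [multinom nth 0%N [:: val t.1; val t.2; (e - t.1 - t.2)%N] i | i < 3].
have degmon t : mdeg (mon t) = e.
  rewrite mdeg3 /mon !mnmE /= -subnDA subnKC //.
  by rewrite /e mul2n -addnn leq_add // -ltnS.
have inj_mon : injective mon.
  move=> [a b] [a' b'] /mnmP E; have := E i0; have := E i1; rewrite /mon !mnmE /=.
  by move=> /val_inj -> /val_inj ->.
pose phi := msubst (polyC : {rmorphism K -> {poly K}}) p.
have sphi t : (size (phi 'X_[mon t]) <= (e * d).+1)%N.
  rewrite mpolyXE_id rmorph_prod -(degmon t) mdegE.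
  have sX i k : (size (p i ^+ k) <= (k * d).+1)%N.
    elim: k => [|k IH]; first by rewrite expr0 size_poly1.
    rewrite exprS (leq_trans (size_polyMleq _ _)) // mulSn.
    have : (size (p i) <= d)%N by apply: (leq_bigmax i).
    by move: IH; move: (size (p i)) (size _) => a b; lia.
  rewrite big_distrl /=.
  apply: (big_ind2 (fun (x : {poly K}) y => (size x <= y.+1)%N)) => [|x1 y1 x2 y2 h1 h2|i _].
  - by rewrite size_poly1.
  - rewrite (leq_trans (size_polyMleq _ _)) //; move: h1 h2.
    by move: (size x1) (size x2) => a b; lia.
  - by rewrite rmorphXn /phi msubstX.
have [|c [[t0 nt0] c0]] := poly_lin_dep sphi.
  rewrite card_prod !card_ord /e /N; nia.
exists (\sum_t c t *: 'X_[mon t]), e; split.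
- apply/eqP => /(congr1 (mcoeff (mon t0))); rewrite raddf_sum mcoeff0 (bigD1 t0) //= big1.
    by rewrite addr0 mcoeffZ mcoeffX (eqxx (mon t0)) mulr1 => E; rewrite E eqxx in nt0.
  by move=> t nt; rewrite mcoeffZ mcoeffX (inj_eq inj_mon) (negbTE nt) mulr0.
- by apply: rpred_sum => t _; rewrite rpredZ // dhomogX /= degmon.
rewrite rmorph_sum -[RHS]c0; apply: eq_bigr => t _.
by rewrite msubstZ mul_polyC.
Qed.

End LinearDependence.

Lemma ord3P (P : 'I_3 -> Prop) : P i0 -> P i1 -> P i2 -> forall i, P i.
Proof.
move=> h0 h1 h2 [[|[|[|//]]] hi].
- by rewrite (_ : Ordinal hi = i0) //; apply: val_inj.
- by rewrite (_ : Ordinal hi = i1) //; apply: val_inj.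
- by rewrite (_ : Ordinal hi = i2) //; apply: val_inj.
Qed.

(** * Specializing the resultant at x = z along a line *)

Section Specialization.
Variables (K F : closedFieldType) (iota : {rmorphism K -> F}).
Variables (s : 'I_3 -> {mpoly K[3]}) (d : nat) (M : 'M[K]_3) (z : 'I_3 -> F).
Hypothesis hs : forall i, s i \is d.-homog.
Hypothesis lead2 : (LS M s i2).@[e3 K] != 0.

Local Notation B := {mpoly K[2]}.
Local Notation K5 := {mpoly K[5]}.
Local Notation L := (LS M s).
Local Notation j0 := (ord0 : 'I_2).
Local Notation j1 := (ord_max : 'I_2).
Implicit Types (o : option K) (j : 'I_3).

Lemma homog_LS i : L i \is d.-homog.
Proof. by apply: rpred_sum => j _; apply: rpredZ; apply: hs. Qed.

Definition Jg j : {poly K5} :=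
  ('X_(xvar i2))%:P * t3m (L j) - ('X_(xvar j))%:P * t3m (L i2).

Definition Jlead j : K5 :=
  (L j).@[e3 K] *: 'X_(xvar i2) - (L i2).@[e3 K] *: 'X_(xvar j).

Lemma Jg_coef j : (Jg j)`_d = Jlead j.
Proof.
rewrite coefB !coefCM !(t3m_lead (homog_LS _)) /Jlead.
by congr (_ - _); rewrite mulrC mul_mpolyC.
Qed.

Lemma Jlead_neq0 j : j != i2 -> Jlead j != 0.
Proof.
move=> nj; apply: contraNneq lead2 => /(congr1 (mcoeff U_(xvar j))).
rewrite mcoeffB !mcoeffZ !mcoeffX mcoeff0 (eqxx (U_(xvar j))%MM) mulr1.
have -> : (U_(xvar i2) == U_(xvar j))%MM = false.
  apply/negbTE; apply: contraNneq nj => /mnmP/(_ (xvar i2)); rewrite !mnm1E eqxx.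
  by case: eqP => // /(@rshift_inj 2 3) ->.
by rewrite mulr0 sub0r => /eqP; rewrite oppr_eq0.
Qed.

Lemma Jg_size j : j != i2 -> size (Jg j) = d.+1.
Proof.
move=> nj; apply/eqP; rewrite eqn_leq; apply/andP; split; last first.
  rewrite leqNgt ltnS; apply: contraNN (Jlead_neq0 nj) => sz.
  by rewrite -Jg_coef nth_default.
have sz k i : (size (('X_(xvar k))%:P * t3m (L i) : {poly K5})%R <= d.+1)%N.
  by rewrite mul_polyC (leq_trans (size_scale_leq _ _)) // t3m_size // homog_LS.
by rewrite (leq_trans (size_polyD _ _)) // size_polyN geq_max !sz.
Qed.

Lemma Jg_lead j : j != i2 -> lead_coef (Jg j) = Jlead j.
Proof. by move=> nj; rewrite lead_coefE Jg_size //= Jg_coef. Qed.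

Lemma ResJE : ResJ M s = resultant (Jg i0) (Jg i1).
Proof. by rewrite /ResJ /J1 /J2 !to_t3polyE. Qed.

Lemma homog_ResJ mu : (toX (ResJ M s))@_mu \is (d * d).-homog.
Proof.
rewrite mcoeff_toX; apply: homog_coeff_x; rewrite ResJE.
apply: wscale_resultant; try exact: Jg_size.
all: by apply: graded_xB; apply: graded_t3m; apply: homog_LS.
Qed.

Definition imap : {rmorphism {mpoly K[3]} -> {mpoly F[3]}} :=
  msubst (mpolyC 3 (R := F) \o iota : {rmorphism K -> {mpoly F[3]}}) (fun i => 'X_i).

Lemma imapE p : map_mpoly iota p = imap p.
Proof. by rewrite /imap msubstE. Qed.

Lemma imapC c : imap c%:MP = (iota c)%:MP. Proof. exact: msubstC. Qed.
Lemma imapX i : imap 'X_i = 'X_i. Proof. exact: msubstX. Qed.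

Lemma homog_imap n p : p \is n.-homog -> imap p \is n.-homog.
Proof.
move=> hp; rewrite -imapE; apply/dhomogP => m.
rewrite mcoeff_msupp mcoeff_map_mpoly => nm; apply: (dhomog_mf hp).
by rewrite mcoeff_msupp; apply: contraNneq nm => ->; rewrite raddf0.
Qed.

Definition genev : {rmorphism {mpoly K[3]} -> F} := msubst iota z.

Hypothesis gen_z : forall P : {mpoly K[3]}, P != 0 -> genev P != 0.

Lemma genevX i : genev 'X_i = z i. Proof. exact: msubstX. Qed.
Lemma genevC c : genev c%:MP = iota c. Proof. exact: msubstC. Qed.

Lemma gen_z_neq0 i : z i != 0.
Proof.
rewrite -genevX gen_z //; apply/eqP => /(congr1 (mcoeff U_(i))).
by rewrite mcoeffX mcoeff0 (eqxx U_(i)%MM) => /eqP; rewrite oner_eq0.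
Qed.

Definition chart2c o (j : 'I_2) : {poly F} :=
  if j == j0 then chart1 (omap iota o) else chart2 (omap iota o).

(** Near the direction [o], t1 and t2 become polynomials in the local parameter u; [psi] and [phi]
    also put x = z. *)
Definition theta o : {rmorphism B -> {poly F}} :=
  msubst (polyC \o iota : {rmorphism K -> {poly F}}) (chart2c o).

Definition psi o : {rmorphism {mpoly B[3]} -> {poly F}} :=
  msubst (theta o) (fun j => (z j)%:P).

Definition phi o : {rmorphism K5 -> {poly F}} := psi o \o @toX K.

Lemma thetaC o c : theta o c%:MP = (iota c)%:P. Proof. exact: msubstC. Qed.
Lemma thetaX o (j : 'I_2) : theta o 'X_j = chart2c o j. Proof. exact: msubstX. Qed.
Lemma psiC o c : psi o c%:MP = theta o c. Proof. exact: msubstC. Qed.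
Lemma psiX o j : psi o 'X_j = (z j)%:P. Proof. exact: msubstX. Qed.

Lemma phiC o c : phi o c%:MP = (iota c)%:P.
Proof. by rewrite /= /toX msubstC /= psiC thetaC. Qed.
Lemma phit o (j : 'I_2) : phi o 'X_(tvar j) = chart2c o j.
Proof. by rewrite /= toXt psiC thetaX. Qed.
Lemma phix o j : phi o 'X_(xvar j) = (z j)%:P.
Proof. by rewrite /= toXx psiX. Qed.

Lemma phi_t3m o p : map_poly (phi o) (t3m p) = aff (omap iota o) (imap p).
Proof.
rewrite -[LHS]/((map_poly (phi o) \o @t3m K : {rmorphism _ -> _}) p).
rewrite -[RHS]/((aff (omap iota o) \o imap : {rmorphism _ -> _}) p).
apply: mpoly_rmorph_ext => [c|].
  transitivity (map_poly (phi o) (c%:MP)%:P); last first.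
    by rewrite map_polyC [RHS]/= imapC affC; congr (_%:P); apply: phiC.
  by rewrite [LHS]/=; congr (map_poly _ _); apply: msubstC.
apply: ord3P; rewrite [LHS]/= [RHS]/= imapX affX t3mX /chart /=.
- by rewrite map_polyC; congr (_%:P); apply: phit.
- by rewrite map_polyC; congr (_%:P); apply: phit.
- by rewrite map_polyX.
Qed.

(** [fz i0] and [fz i1] are f and g, the values of J_1 and J_2 at x = z; [flead] is their
    coefficient of t3^d. *)
Definition fz j : {mpoly F[3]} := z i2 *: imap (L j) - z j *: imap (L i2).

Definition flead j : F := z i2 * iota ((L j).@[e3 K]) - z j * iota ((L i2).@[e3 K]).

Lemma homog_fz j : fz j \is d.-homog.
Proof. by rewrite rpredB // rpredZ // homog_imap // homog_LS. Qed.

Lemma phi_J o j : map_poly (phi o) (Jg j) = aff (omap iota o) (fz j).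
Proof.
have xE k : map_poly (phi o) ('X_(xvar k))%:P = (z k)%:P%:P.
  by rewrite map_polyC; congr (_%:P); apply: phix.
by rewrite /Jg rmorphB !rmorphM [LHS]/= !xE !phi_t3m /fz rmorphB !affZ.
Qed.

Lemma phi_Jlead o j : phi o (Jlead j) = (flead j)%:P.
Proof.
rewrite /Jlead rmorphB -!mul_mpolyC !rmorphM !phiC !phix /flead.
by rewrite polyCB !polyCM ![(iota _)%:P * _]mulrC.
Qed.

(** This is the value at the generic z of a linear form over K whose j-th coefficient is
    -L_3(0:0:1). *)
Lemma flead_neq0 j : j != i2 -> flead j != 0.
Proof.
move=> nj; rewrite (_ : flead j = genev ((L j).@[e3 K] *: 'X_i2 - (L i2).@[e3 K] *: 'X_j)).
  apply: gen_z; apply: contraNneq lead2 => /(congr1 (mcoeff U_(j))).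
  rewrite mcoeffB !mcoeffZ !mcoeffX mcoeff0 (eqxx (U_(j))%MM) mulr1.
  have -> : (U_(i2) == U_(j))%MM = false.
    apply/negbTE; apply: contraNneq nj => /mnmP/(_ i2); rewrite !mnm1E eqxx.
    by case: eqP => // ->.
  by rewrite mulr0 sub0r => /eqP; rewrite oppr_eq0.
rewrite rmorphB -!mul_mpolyC !rmorphM !genevC !genevX /flead.
by rewrite mulrC [z j * _]mulrC.
Qed.

Lemma phi_lead_neq0 o j : j != i2 -> phi o (lead_coef (Jg j)) != 0.
Proof. by move=> nj; rewrite Jg_lead // phi_Jlead polyC_eq0 flead_neq0. Qed.

Lemma lead_aff_fz o j : j != i2 -> lead_coef (aff (omap iota o) (fz j)) = (flead j)%:P.
Proof.
by move=> nj; rewrite -phi_J lead_coef_map_id0 ?rmorph0 ?phi_lead_neq0 // Jg_lead // phi_Jlead.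
Qed.

Lemma phi_ResJ o : phi o (ResJ M s) =
  resultant (aff (omap iota o) (fz i0)) (aff (omap iota o) (fz i1)).
Proof.
rewrite ResJE.
rewrite (resultant_map (phi_lead_neq0 o (isT : i0 != i2)) (phi_lead_neq0 o (isT : i1 != i2))).
by congr resultant; apply: phi_J.
Qed.

Lemma theta_ev0 o p : (theta o p).[0] = iota p.@[dir o].
Proof.
rewrite -[LHS]/((horner_eval 0 \o theta o : {rmorphism _ -> _}) p).
rewrite -[RHS]/((iota \o meval (dir o) : {rmorphism _ -> _}) p).
apply: mpoly_rmorph_ext => [c|].
  by rewrite [LHS]/= [RHS]/= thetaC mevalC /horner_eval hornerC.
by apply: ord2P; rewrite [LHS]/= [RHS]/= thetaX mevalXU /horner_eval /chart2c /dir /=;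
  case: o => [y|] /=; rewrite ?hornerD ?hornerX ?hornerC ?add0r ?rmorph0 ?rmorph1.
Qed.

Lemma theta_lin2 o : theta o (lin2 o) = 'X.
Proof.
case: o => [y|]; rewrite [lin2 _]/=; last by rewrite thetaX.
rewrite rmorphB -mul_mpolyC rmorphM thetaC !thetaX /chart2c /=.
by rewrite mulr1 addrK.
Qed.

Lemma lin2_dir_neq0 o o' : o != o' -> (lin2 o').@[dir o] != 0.
Proof.
case: o' => [y'|]; rewrite [lin2 _]/=; last first.
  by rewrite mevalXU /dir; case: o => //= y _; rewrite oner_eq0.
rewrite mevalB mevalZ !mevalXU /dir; case: o => [y|] /=; last first.
  by rewrite mulr0 subr0 oner_eq0.
by rewrite mulr1 subr_eq0 => ny; apply: contraNneq ny => ->.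
Qed.

Lemma theta_lins o D : exists e, e.[0] != 0 /\ theta o (lins D) = 'X^(count_mem o D) * e.
Proof.
elim: D => [|o' D [e [ne eE]]].
  exists 1; rewrite hornerC oner_neq0 /= expr0 mulr1; split=> //.
  by rewrite /lins big_nil rmorph1.
rewrite /lins big_cons rmorphM -/(lins D) eE /=.
have [->|no] := eqVneq o' o; first by exists e; rewrite theta_lin2 add1n exprS mulrA.
exists (theta o (lin2 o') * e); rewrite hornerM theta_ev0 add0n; split; last by rewrite mulrCA.
by rewrite mulf_neq0 // fmorph_eq0 lin2_dir_neq0 // eq_sym.
Qed.

(** Only the factors [lin2 o] of the content vanish at u = 0. The primitive part becomes there a
    nonzero polynomial over K evaluated at z, hence a unit, so the order of the resultant is
    [count_mem o D]. *)
Lemma fiber_chain D P' o : toX (ResJ M s) = lins D *: P' ->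
  (exists mu, (P'@_mu).@[dir o] != 0) ->
  exists bs, chain (ideal2 (aff (omap iota o) (fz i0)) (aff (omap iota o) (fz i1))) bs /\
             size bs = count_mem o D.
Proof.
move=> RE [mu nmu]; have [e [ne eE]] := theta_lins o D.
apply: (@resultant_length _ _ _ (flead i0) (flead i1) (e * psi o P')).
- exact: flead_neq0.
- exact: flead_neq0.
- exact: lead_aff_fz.
- exact: lead_aff_fz.
- rewrite hornerM mulf_neq0 //.
  have -> : (psi o P').[0] = genev (map_mpoly (meval (dir o)) P').
    rewrite -[LHS]/((horner_eval 0 \o psi o : {rmorphism _ -> _}) P').
    rewrite -[RHS]/((genev \o map_mpoly (meval (dir o)) : {rmorphism _ -> _}) P').
    apply: mpoly_rmorph_ext => [c|j]; rewrite [LHS]/= [RHS]/=.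
      by rewrite psiC map_mpolyC genevC /horner_eval theta_ev0.
    by rewrite psiX map_mpolyX genevX /horner_eval hornerC.
  apply: gen_z; apply/eqP => /(congr1 (mcoeff mu)); rewrite mcoeff_map_mpoly mcoeff0.
  by move=> E; rewrite [X in X != 0]E eqxx in nmu.
- by rewrite -phi_ResJ /= RE -mul_mpolyC rmorphM psiC eE mulrA.
Qed.

End Specialization.

Lemma LS_inv (K : fieldType) (M : 'M[K]_3) (s : 'I_3 -> {mpoly K[3]}) i :
  M \in unitmx -> s i = \sum_(j < 3) invmx M i j *: LS M s j.
Proof.
move=> uM; have E k : \sum_j invmx M i j * M j k = (i == k)%:R.
  by have := congr1 (fun X : 'M_3 => X i k) (mulVmx uM); rewrite !mxE.
transitivity (\sum_k (\sum_j invmx M i j * M j k) *: s k).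
  rewrite (bigD1 i) //= E eqxx scale1r big1 ?addr0 // => k nk.
  by rewrite E eq_sym (negbTE nk) scale0r.
under eq_bigr do rewrite scaler_suml.
rewrite exchange_big; apply: eq_bigr => j _; rewrite /LS scaler_sumr.
by apply: eq_bigr => k _; rewrite scalerA.
Qed.

(** * Restriction of forms to lines over K *)

Section Lines.
Variable K : fieldType.
Implicit Types (o : option K) (p : {mpoly K[3]}).

Definition line_coord o : {rmorphism {mpoly K[5]} -> K} :=
  msubst (idfun : {rmorphism K -> K}) (fun i : 'I_5 =>
    match split (i : 'I_(2 + 3)) with inl j => pt o 0 (widen_ord (leqnSn 2) j) | inr _ => 0 end).

(** Factored through [t3m] so that [t3m_lead] gives the coefficient of t3^d. *)
Definition line o : {rmorphism {mpoly K[3]} -> {poly K}} :=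
  map_poly (line_coord o) \o t3m.

Lemma line_coordt o (j : 'I_2) :
  line_coord o 'X_(tvar j) = pt o 0 (widen_ord (leqnSn 2) j).
Proof. by rewrite /line_coord msubstX (@split_lshift 2 3). Qed.

Lemma lineC o c : line o c%:MP = c%:P.
Proof.
rewrite [LHS]/= (_ : t3m c%:MP = (c%:MP)%:P); last exact: msubstC.
by rewrite map_polyC; congr (_%:P); apply: msubstC.
Qed.

Lemma lineX o i : line o 'X_i =
  nth 'X [:: (chart1 o).[0]%:P; (chart2 o).[0]%:P; 'X] i.
Proof.
rewrite [LHS]/= t3mX; move: i; apply: ord3P => /=.
- by rewrite map_polyC; congr (_%:P); apply: line_coordt.
- by rewrite map_polyC; congr (_%:P); apply: line_coordt.
- by rewrite map_polyX.
Qed.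

Lemma line_lead o d p : p \is d.-homog -> (line o p)`_d = p.@[e3 K].
Proof.
move=> hp; rewrite [line o p]/= coef_map (t3m_lead hp); exact: msubstC.
Qed.

Lemma line_ev o p b : (line o p).[b] = p.@[pt o b].
Proof.
rewrite -[LHS]/((horner_eval b \o line o : {rmorphism _ -> _}) p).
rewrite -[RHS]/((meval (pt o b) : {rmorphism _ -> _}) p).
apply: mpoly_rmorph_ext => [c|i].
  by rewrite [LHS]/(horner_eval b (line o c%:MP)) lineC [RHS]/= mevalC /horner_eval hornerC.
rewrite [LHS]/(horner_eval b (line o 'X_i)) lineX [RHS]/= mevalXU /horner_eval /pt.
by move: i; apply: ord3P => /=; rewrite ?hornerC ?hornerX.
Qed.

End Lines.

(** * Common zeros of f and g on a line over K *)

Section CommonZeros.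
Variables (K F : closedFieldType) (iota : {rmorphism K -> F}).
Variables (s : 'I_3 -> {mpoly K[3]}) (d : nat) (M : 'M[K]_3) (z : 'I_3 -> F).
Hypothesis hs : forall i, s i \is d.-homog.
Hypothesis lead2 : (LS M s i2).@[e3 K] != 0.
Hypothesis uM : M \in unitmx.
Hypothesis gen_z : forall P : {mpoly K[3]}, P != 0 -> genev iota z P != 0.

Lemma line_imap o p b :
  (map_poly iota (line o p)).[b] = (imap iota p).@[pt (omap iota o) b].
Proof.
rewrite -[LHS]/((horner_eval b \o (map_poly iota \o line o) : {rmorphism _ -> _}) p).
rewrite -[RHS]/((meval (pt (omap iota o) b) \o imap iota : {rmorphism _ -> _}) p).
apply: mpoly_rmorph_ext => [c|i].
  rewrite [LHS]/(horner_eval b (map_poly iota (line o c%:MP))) lineC map_polyC.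
  by rewrite [RHS]/= imapC mevalC /horner_eval hornerC.
rewrite [LHS]/(horner_eval b (map_poly iota (line o 'X_i))) lineX.
rewrite [RHS]/= imapX mevalXU /horner_eval /pt.
move: i; apply: ord3P => /=; rewrite ?map_polyC ?map_polyX ?hornerC ?hornerX //.
  by case: o => [y|] /=; rewrite ?hornerC ?hornerX ?rmorph0 ?rmorph1.
by case: o => [y|] /=; rewrite ?hornerD ?hornerC ?hornerX ?add0r ?rmorph1.
Qed.

(* Away from the base points the map sends the line to a curve over K, which
   cannot pass through the generic point z. *)
Lemma common_zero_base o b :
  (fz iota s M z i0).@[pt (omap iota o) b] = 0 ->
  (fz iota s M z i1).@[pt (omap iota o) b] = 0 ->
  exists2 b', b = iota b' & forall i, (s i).@[pt o b'] = 0.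
Proof.
move=> f0 f1; pose p j := line o (LS M s j); pose a j := (map_poly iota (p j)).[b].
have nz i : z i != 0 by apply: gen_z_neq0 gen_z i.
have az j : z i2 * a j = z j * a i2.
  move: j; apply: ord3P => //; apply/eqP; rewrite -subr_eq0; apply/eqP;
    by rewrite /a /p !line_imap -!mevalZ -mevalB.
have a2 : a i2 = 0.
  apply/eqP/negPn/negP => na; have [G [e [nG hG G0]]] := poly3_relation p.
  pose aev : {rmorphism {mpoly K[3]} -> F} := msubst iota a.
  have aevC c : aev c%:MP = iota c by apply: msubstC.
  have aevX i : aev 'X_i = a i by apply: msubstX.
  have : aev G = 0.
    have <- : (horner_eval b \o (map_poly iota \o msubst (polyC : {rmorphism K -> {poly K}}) p)
        : {rmorphism _ -> _}) G = aev G.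
      apply: mpoly_rmorph_ext => [c|i].
        rewrite [LHS]/(horner_eval b (map_poly iota (msubst _ p c%:MP))) msubstC map_polyC.
        by rewrite aevC /horner_eval hornerC.
      rewrite [LHS]/(horner_eval b (map_poly iota (msubst _ p 'X_i))) msubstX.
      by rewrite aevX.
    by rewrite [LHS]/(horner_eval b (map_poly iota (msubst _ p G))) G0 (rmorph0 (map_poly iota)) /horner_eval horner0.
  move=> aG; have := gen_z nG.
  rewrite (_ : genev iota z G = (z i2 / a i2) ^+ e * aev G); last first.
    apply: homog_scale hG => [c|i]; first by rewrite genevC aevC.
    by rewrite genevX aevX mulrAC az mulfK.
  by rewrite aG mulr0 eqxx.
have a0 j : a j = 0.
  by have /eqP := az j; rewrite a2 mulr0 mulf_eq0 (negbTE (nz i2)) => /eqP.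
have np2 : p i2 != 0.
  apply: contraNneq lead2 => p0.
  by rewrite -(line_lead o (homog_LS M hs i2)) -/(p i2) p0 coef0.
(* b is now a root of a nonzero polynomial over the algebraically closed K, so it comes from K. *)
have [rs rsE] := closed_field_poly_normal (p i2).
have [b' _ bE] : exists2 b', b' \in rs & b = iota b'.
  have /eqP := a2; rewrite /a rsE map_polyZ hornerZ mulf_eq0 fmorph_eq0 lead_coef_eq0.
  rewrite (negbTE np2) /= rmorph_prod horner_prod prodf_seq_eq0 => /hasP[b' b'rs] /=.
  rewrite rmorphB /= map_polyX map_polyC hornerXsubC subr_eq0 => /eqP ->.
  by exists b'.
exists b' => // i; rewrite (LS_inv s i uM) rmorph_sum big1 // => j _.
rewrite /= mevalZ; have := a0 j; rewrite /a bE horner_map /p line_ev => /eqP.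
by rewrite fmorph_eq0 => /eqP ->; rewrite mulr0.
Qed.

End CommonZeros.

(** * Existence of a line without base points *)

Section CoprimeLine.
Variable K : closedFieldType.
Local Notation A := {poly {poly K}}.
Implicit Types (y : K) (p q h : A).

Lemma horner_coef_factor y p : map_poly (horner_eval y) p = 0 ->
  exists q, p = q * ('X - y%:P)%:P.
Proof.
move=> p0; exists (map_poly (fun c : {poly K} => c %/ ('X - y%:P)) p).
apply/polyP => i; rewrite coefMC coef_map_id0 ?div0p // divpK //.
rewrite dvdp_XsubCl; apply/rootP.
by have := congr1 (fun q : {poly K} => q`_i) p0; rewrite coef_map coef0.
Qed.

(* Gauss's lemma: a linear factor X - y of the denominator divides h or all
   three cofactors, since it is prime in K[u][v]. *)
Lemma gauss_peel (p : 'I_3 -> A) rs h :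
  (forall i, exists q, (\prod_(y <- rs) ('X - y%:P))%:P * p i = q * h) ->
  exists h', size h' = size h /\ forall i, exists q, p i = q * h'.
Proof.
elim: rs h => [|y rs IH] h H.
  by exists h; split=> // i; have [q] := H i; rewrite big_nil mul1r => ->; exists q.
have npi : ('X - y%:P)%:P != 0 :> A by rewrite polyC_eq0 polyXsubC_eq0.
have [/horner_coef_factor[h1 h1E]|nh] := eqVneq (map_poly (horner_eval y) h) 0.
  have [|h' [sh' dh']] := IH h1.
    move=> i; have [q qE] := H i; exists q; apply: (mulIf npi).
    have -> : q * h1 * ('X - y%:P)%:P = q * h by rewrite h1E mulrA.
    by rewrite -qE big_cons polyCM mulrC mulrA.
  by exists h'; rewrite sh' h1E mulrC size_Cmul // polyXsubC_eq0.
apply: IH => i; have [q qE] := H i.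
have /horner_coef_factor[q' q'E] : map_poly (horner_eval y) q = 0.
  have /eqP := congr1 (map_poly (horner_eval y)) qE; rewrite !rmorphM /= map_polyC /=.
  rewrite big_cons /horner_eval hornerM hornerXsubC subrr mul0r polyC0 mul0r eq_sym mulf_eq0.
  by rewrite (negbTE nh) orbF => /eqP.
exists q'; apply: (mulIf npi).
have -> : q' * h * ('X - y%:P)%:P = q * h by rewrite q'E mulrAC.
by rewrite -qE big_cons polyCM mulrC mulrA.
Qed.

Lemma poly_nonroot (c : {poly K}) : c != 0 -> exists y, c.[y] != 0.
Proof.
move=> nc; apply: NNPP => H.
have c0 y : c.[y] = 0 by apply/eqP/negPn/negP => ny; apply: H; exists y.
(* If c vanished everywhere, the nonconstant c X + 1 would have no root. *)
have /closed_rootP[y /rootP] : size (c * 'X + 1) != 1%N.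
  by rewrite -[1](polyC1) size_MXaddC (negbTE nc) /= eqSS size_poly_eq0.
by rewrite hornerD hornerM c0 mul0r add0r hornerC => /eqP; rewrite oner_eq0.
Qed.

Lemma aff0_ev (p : {mpoly K[3]}) y b : (aff (Some 0) p).[b%:P].[y] = p.@[pt (Some y) b].
Proof.
rewrite -[LHS]/((horner_eval y \o (horner_eval b%:P \o aff (Some 0)) : {rmorphism _ -> _}) p).
rewrite -[RHS]/((meval (pt (Some y) b) : {rmorphism _ -> _}) p).
apply: mpoly_rmorph_ext => [c|i].
  rewrite [LHS]/(horner_eval y (horner_eval b%:P (aff _ c%:MP))) affC [RHS]/= mevalC.
  by rewrite /horner_eval !hornerC.
rewrite [LHS]/(horner_eval y (horner_eval b%:P (aff _ 'X_i))) affX [RHS]/= mevalXU.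
rewrite /horner_eval /chart /pt; move: i; apply: ord3P => /=;
  by rewrite ?(hornerC, hornerX, hornerD, addr0, add0r).
Qed.

Lemma rdvd_X0 (p q : {mpoly K[3]}) : rdvd 'X_i0 (p * q) -> rdvd 'X_i0 p \/ rdvd 'X_i0 q.
Proof.
pose f : {rmorphism {mpoly K[3]} -> {mpoly K[3]}} :=
  msubst (mpolyC 3 (R := K) : {rmorphism K -> {mpoly K[3]}}) (fun i => if i == i0 then 0 else 'X_i).
have fX i : f 'X_i = if i == i0 then 0 else 'X_i by apply: msubstX.
have D (r : {mpoly K[3]}) : rdvd 'X_i0 r <-> f r = 0.
  apply: rdvd_retract => [c|i|]; first exact: msubstC.
    rewrite fX; case: eqP => [->|_]; first by exists 1; rewrite subr0 mul1r.
    by exists 0; rewrite subrr mul0r.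
  by rewrite fX eqxx.
move=> /D; rewrite rmorphM => /eqP; rewrite mulf_eq0.
by move=> /orP[] /eqP ?; [left|right]; apply/D.
Qed.

Lemma X0_neq0 : 'X_i0 != 0 :> {mpoly K[3]}.
Proof.
apply/eqP => /(congr1 (aff (Some 0))); rewrite affX rmorph0 /chart /= => /eqP.
by rewrite polyC1 oner_eq0.
Qed.

(** Homogenizing a factorization introduces powers of t1. As t1 is prime they can be cancelled, and
    as it restricts to 1 the chart polynomial of H is unchanged. *)
Lemma peel_X0 (s : 'I_3 -> {mpoly K[3]}) k H :
  (forall i, exists Q, 'X_i0 ^+ k * s i = Q * H) ->
  exists H', aff (Some 0) H' = aff (Some 0) H /\ forall i, rdvd H' (s i).
Proof.
elim: k H => [|k IH] H HQ.
  by exists H; split=> // i; have [Q] := HQ i; rewrite expr0 mul1r => ->; exists Q.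
have [[H1 H1E]|nH] := classic (rdvd 'X_i0 H).
  have [|H' [aH' dH']] := IH H1.
    move=> i; have [Q QE] := HQ i; exists Q; apply: (mulIf X0_neq0).
    have -> : Q * H1 * 'X_i0 = Q * H by rewrite H1E mulrA.
    by rewrite -QE exprS mulrC mulrA.
  exists H'; split=> //; rewrite aH' H1E rmorphM affX /chart /= polyC1 mulr1 //.
apply: IH => i; have [Q QE] := HQ i.
have /rdvd_X0[[Q' Q'E]|//] : rdvd 'X_i0 (Q * H).
  by exists ('X_i0 ^+ k * s i); rewrite -QE exprS -mulrA mulrC.
exists Q'; apply: (mulIf X0_neq0).
have -> : Q' * H * 'X_i0 = Q * H by rewrite Q'E mulrAC.
by rewrite -QE exprS mulrC mulrA.
Qed.

(** Homogenized and freed from powers of t1, h would become a common divisor of the s_i, hence a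
    constant, against its positive degree in v. *)
Lemma no_common_factor (s : 'I_3 -> {mpoly K[3]}) d h :
  (forall i, s i \is d.-homog) -> coprime3 s -> (1 < size h)%N ->
  ~ forall i, exists q, aff (Some 0) (s i) = q * h.
Proof.
move=> hs cop sh /fin_all_exists[q qE].
have [n0 /(_ n0 (leqnn _))[H hH HE]] := homog_lift (Some 0) h.
have /fin_all_exists[N HN] i : exists n0, forall n, (n0 <= n)%N ->
    exists2 p, p \is n.-homog & aff (Some 0) p = q i by apply: homog_lift.
pose n := (\max_i N i + d)%N.
have [|H' [aH' dH']] := @peel_X0 s (n + n0 - d) H.
  move=> i; have [|Q hQ QE] := HN i n; first by rewrite /n (leq_trans (leq_bigmax i)) ?leq_addr.
  exists Q; apply/eqP; rewrite -subr_eq0; apply/eqP; apply: (@aff_homog_inj _ (Some 0) (n + n0)).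
    apply: rpredB; last exact: dhomogM.
    have dn : (d <= n + n0)%N by apply: leq_trans (leq_addr n0 n); rewrite /n leq_addl.
    have hX := dhomogMn (n + n0 - d) (homog_oth3 (Some (0 : K))).
    by have := dhomogM hX (hs i); rewrite mul1n (subnK dn).
  rewrite rmorphB !rmorphM rmorphXn affX HE QE qE /chart /= polyC1 expr1n mul1r subrr //.
have [c [nc cE]] := cop H' dH'.
move: sh; rewrite -HE -aH' cE affC ltnNge size_polyC.
by case: (_ != _).
Qed.

(** The restrictions to the chart have no common factor of positive degree in v, so they satisfy a
    Bezout identity with right-hand side a nonzero C in K[u]. On a line u = y with C(y) nonzero they
    cannot vanish together. *)
Lemma coprime_line (s : 'I_3 -> {mpoly K[3]}) d :
  (forall i, s i \is d.-homog) -> coprime3 s -> (exists i, s i != 0) ->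
  exists y, forall b, exists i, (s i).@[pt (Some y) b] != 0.
Proof.
move=> hs cop [i ni]; pose p i := aff (Some 0) (s i).
pose h := gcdp (gcdp (p i0) (p i1)) (p i2).
have dvdh j : h %| p j.
  move: j; apply: ord3P; rewrite /h.
  - by rewrite (dvdp_trans (dvdp_gcdl _ _)) // dvdp_gcdl.
  - by rewrite (dvdp_trans (dvdp_gcdl _ _)) // dvdp_gcdr.
  - by rewrite dvdp_gcdr.
have nh : h != 0.
  apply: contraNneq ni => h0; have := dvdh i; rewrite h0 dvd0p => /eqP pi0.
  by apply/eqP; apply: aff_homog_inj (hs i) pi0.
have [sh|sh] := leqP (size h) 1; last first.
  (* [gcdp] divides only up to factors from K[u]; a common denominator C is split into linear
     factors for [gauss_peel]. *)
  have /fin_all_exists[c Hc] j : exists c : {poly K}, c != 0 /\ exists q, c%:P * p j = q * h.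
    have /Pdiv.Idomain.dvdpP[[c q] /= nc cE] := dvdh j.
    by exists c; split=> //; exists q; rewrite mul_polyC.
  pose C := \prod_j c j.
  have nC : C != 0 by apply/prodf_neq0 => j _; have [] := Hc j.
  have [rs rsE] := closed_field_poly_normal C.
  have [|h' [sh' dh']] := @gauss_peel p rs h.
    move=> j; have [_ [q qE]] := Hc j.
    exists (((lead_coef C)^-1)%:P%:P * (\prod_(k | k != j) c k)%:P * q).
    rewrite -!mulrA -qE [_ * (_ * p j)]mulrA -polyCM mulrA -polyCM; congr (_%:P * _).
    have -> : (\prod_(k | k != j) c k) * c j = C by rewrite mulrC /C [RHS](bigD1 j).
    transitivity ((lead_coef C)^-1%:P * (lead_coef C *: \prod_(y <- rs) ('X - y%:P))).
      by rewrite -mul_polyC mulrA -polyCM mulVf ?lead_coef_eq0 // mul1r.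
    by rewrite -rsE.
  by case: (@no_common_factor s d h' hs cop) => //; rewrite sh'.
have [[u1 u2] /= E1] := Bezoutp (p i0) (p i1).
have [[w1 w2] /= E2] := Bezoutp (gcdp (p i0) (p i1)) (p i2).
have [k nk kE] : exists2 k : {poly K}, k != 0 & h = k%:P.
  exists h`_0; last exact: size1_polyC.
  by apply: contraNneq nh => h0; rewrite (size1_polyC sh) h0.
move: E1 => /Pdiv.Idomain.eqpP[[c1 c2] /= /andP[nc1 nc2] E1].
move: E2 => /Pdiv.Idomain.eqpP[[c3 c4] /= /andP[nc3 nc4] E2].
pose C := c2 * c4 * k.
have nC : C != 0 by rewrite !mulf_neq0.
have [y ny] := poly_nonroot nC; exists y => b; apply: NNPP => nb.
have p0 j : (p j).[b%:P].[y] = 0.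
  by rewrite aff0_ev; apply/eqP/negPn/negP => nz; apply: nb; exists j.
have CE : C%:P = c3%:P * (w1 * c1%:P * (u1 * p i0 + u2 * p i1) + c2%:P * (w2 * p i2)).
  have -> : C%:P = c2%:P * (c4%:P * k%:P) by rewrite !polyCM mulrA.
  rewrite -kE [c4%:P * h]mul_polyC -E2 -mul_polyC.
  have -> : w1 * c1%:P * (u1 * p i0 + u2 * p i1) = w1 * (c2%:P * gcdp (p i0) (p i1)).
    by rewrite -mulrA !mul_polyC E1.
  by move: (gcdp _ _) => g; ring.
case/eqP: ny; have := congr1 (fun q : A => q.[b%:P].[y]) CE.
by rewrite hornerC !(hornerM, hornerD) !p0 !(mulr0, addr0).
Qed.

End CoprimeLine.

(** * The labels of a chain are the common zeros on u = 0 *)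

Section Support.
Variable F : closedFieldType.
Local Notation A := {poly {poly F}}.
Implicit Types (I : A -> Prop) (p : A) (b : F) (bs : seq F).

(** An element of I that is a unit at (0, b) would make the local quotient there zero, yet its
    dimension is the positive count of b. *)
Lemma chain_mem_ev I bs b p : is_ideal I -> chain I bs -> b \in bs -> I p -> ev b p = 0.
Proof.
move=> iI ch bbs Ip; apply/eqP/negPn/negP => np.
have [ps [ind _]] := chain_codim b iI ch.
have Lall q : loc I b q by exists p; split=> //; rewrite mulrC; apply: idealM.
have c0 : (0 < count_mem b bs)%N by rewrite -has_count has_pred1.
by have /eqP := ind (fun=> 1) (Lall _) (Ordinal c0); rewrite oner_eq0.
Qed.

(** If b were not listed, 1 would lie in the localized ideal, which is impossible at a common
    zero. *)
Lemma chain_ev_mem f g bs b : chain (ideal2 f g) bs -> ev b f = 0 -> ev b g = 0 -> b \in bs.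
Proof.
move=> ch f0 g0; rewrite -has_pred1 has_count lt0n; apply/negP => /eqP c0.
have [ps [_ spn]] := chain_codim b (is_ideal2 f g) ch.
have [c [h [nh [q [k1 [k2 [nq E]]]]]]] := spn 1.
have : comb c ps = 0 by rewrite /comb big1 // => -[i hi]; exfalso; move: hi; rewrite c0.
have evD p r : ev b (p + r) = ev b p + ev b r by rewrite /ev !hornerD.
move=> cE; have := congr1 (ev b) E; rewrite cE subr0 mulr1 evD !evM evCp f0 g0.
by rewrite !mulr0 addr0 => /eqP; rewrite mulf_eq0 (negbTE nh) (negbTE nq).
Qed.

End Support.

(** * The resultant is not zero *)

Section Nonvanishing.
Variables (K F : closedFieldType) (iota : {rmorphism K -> F}).
Variables (s : 'I_3 -> {mpoly K[3]}) (d : nat) (M : 'M[K]_3) (z : 'I_3 -> F).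
Hypothesis hs : forall i, s i \is d.-homog.
Hypothesis lead2 : (LS M s i2).@[e3 K] != 0.
Hypothesis uM : M \in unitmx.
Hypothesis gen_z : forall P : {mpoly K[3]}, P != 0 -> genev iota z P != 0.

(** A zero resultant stays zero on every line, which gives f and g a common zero even on a line
    without base points, against [common_zero_base]. *)
Lemma ResJ_neq0 : coprime3 s -> (exists i, s i != 0) -> ResJ M s != 0.
Proof.
move=> cop ns; apply/eqP => R0.
have [y ny] := coprime_line hs cop ns.
have := phi_ResJ hs lead2 gen_z (Some y); rewrite R0 rmorph0 => /esym.
set p := aff _ _; set q := aff _ _ => res0.
have lp : lead_coef p = (flead iota s M z i0)%:P by apply: (lead_aff_fz hs lead2 gen_z).
have lq : lead_coef q = (flead iota s M z i1)%:P by apply: (lead_aff_fz hs lead2 gen_z).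
have np : horner_eval (0 : F) (lead_coef p) != 0.
  by rewrite lp /horner_eval hornerC (flead_neq0 lead2 gen_z).
have nq : horner_eval (0 : F) (lead_coef q) != 0.
  by rewrite lq /horner_eval hornerC (flead_neq0 lead2 gen_z).
have /esym/eqP := resultant_map np nq; rewrite res0 rmorph0 resultant_eq0 => sz.
have [b] : exists b, root (gcdp (map_poly (horner_eval (0 : F)) p) (map_poly (horner_eval (0 : F)) q)) b.
  by apply/closed_rootP; rewrite neq_ltn sz orbT.
have evE (r : {poly {poly F}}) : (map_poly (horner_eval (0 : F)) r).[b] = ev b r.
  by rewrite /ev -[b in LHS](hornerC b 0) -[_.[0] in LHS]/(horner_eval 0 b%:P) horner_map.
rewrite root_gcd => /andP[/rootP + /rootP]; rewrite !evE !ev_aff => f0 f1.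
have [b' _ s0] := common_zero_base hs lead2 uM gen_z f0 f1.
by have [i] := ny b'; rewrite s0 eqxx.
Qed.

End Nonvanishing.

(** * Genericity of the cross product *)

Section CrossProduct.
Variables (K : fieldType) (M : 'M[K]_3).
Local Notation vec S := ('I_3 -> S).

Definition tilde (S : comNzRingType) (c : K -> S) (x : vec S) (i : 'I_3) : S :=
  \sum_j x j * c (invmx M j i).

Definition cross (S : comNzRingType) (c : K -> S) (x y : vec S) (i : 'I_3) : S :=
  let xt := tilde c x in let yt := tilde c y in
  nth (xt i0 * yt i1 - xt i1 * yt i0)
    [:: xt i1 * yt i2 - xt i2 * yt i1; xt i2 * yt i0 - xt i0 * yt i2] i.

Lemma tilde_morph (S S' : comNzRingType) (f : {rmorphism S -> S'}) c c' x x' i :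
  (forall a, f (c a) = c' a) -> (forall j, f (x j) = x' j) ->
  f (tilde c x i) = tilde c' x' i.
Proof.
by move=> fc fx; rewrite rmorph_sum; apply: eq_bigr => j _; rewrite rmorphM fc fx.
Qed.

Lemma cross_morph (S S' : comNzRingType) (f : {rmorphism S -> S'}) c c' x x' y y' i :
  (forall a, f (c a) = c' a) -> (forall j, f (x j) = x' j) -> (forall j, f (y j) = y' j) ->
  f (cross c x y i) = cross c' x' y' i.
Proof.
move=> fc fx fy; move: i; apply: ord3P; rewrite /cross /= rmorphB !rmorphM;
  by rewrite !(tilde_morph _ fc fx) !(tilde_morph _ fc fy).
Qed.

Lemma tilde_mul (S : comNzRingType) (c : {rmorphism K -> S}) (x : vec S) i :
  M \in unitmx -> tilde c (fun j => \sum_k x k * c (M k j)) i = x i.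
Proof.
move=> uM; rewrite /tilde; under eq_bigr do rewrite mulr_suml.
rewrite exchange_big /=.
have E k : \sum_j x k * c (M k j) * c (invmx M j i) = x k * c ((k == i)%:R).
  have := congr1 (fun X : 'M_3 => X k i) (mulmxV uM); rewrite !mxE => <-.
  rewrite rmorph_sum mulr_sumr; apply: eq_bigr => j _.
  by rewrite rmorphM mulrA.
under eq_bigr do rewrite E.
rewrite (bigD1 i) //= eqxx rmorph1 mulr1 big1 ?addr0 // => k nk.
by rewrite (negbTE nk) rmorph0 mulr0.
Qed.

(** As x, y are algebraically independent, it is enough that P(z) is nonzero as a polynomial in
    them, and this follows from one specialization of x, y that sends z to three independent
    variables. *)
Lemma cross_generic (F : fieldType) (iota : {rmorphism K -> F}) (x y : vec F) :
  M \in unitmx ->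
  (forall P : {mpoly K[6]}, P != 0 -> (map_mpoly iota P).@[xy6 x y] != 0) ->
  forall P : {mpoly K[3]}, P != 0 -> msubst iota (cross iota x y) P != 0.
Proof.
move=> uM alg P nP; pose K6 := {mpoly K[6]}.
pose c6 : {rmorphism K -> K6} := mpolyC 6 (R := K).
pose X6 (j : 'I_3) : K6 := 'X_(lshift 3 j); pose Y6 (j : 'I_3) : K6 := 'X_(rshift 3 j).
have [g gC gX] := msubst_exists c6 (cross c6 X6 Y6).
have [ev6 ev6C ev6X] := msubst_exists iota (xy6 x y).
have xX j : ev6 (X6 j) = x j by rewrite ev6X /xy6 split_lshift.
have yY j : ev6 (Y6 j) = y j by rewrite ev6X /xy6 split_rshift.
have -> : msubst iota (cross iota x y) P = ev6 (g P).
  rewrite -[RHS]/((ev6 \o g : {rmorphism _ -> _}) P).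
  apply: mpoly_rmorph_ext => [a|i].
    by transitivity (ev6 (g a%:MP)); rewrite // [LHS]msubstC gC ev6C.
  transitivity (ev6 (g 'X_i)) => //; rewrite [LHS]msubstX gX; symmetry.
  by apply: cross_morph => // a; apply: ev6C.
have ev6E Q : ev6 Q = (map_mpoly iota Q).@[xy6 x y].
  rewrite -[RHS]/((meval (xy6 x y) \o map_mpoly iota : {rmorphism _ -> _}) Q).
  apply: mpoly_rmorph_ext => [a|i].
    by rewrite ev6C [RHS]/= map_mpolyC mevalC.
  by rewrite ev6X [RHS]/= map_mpolyX mevalXU.
rewrite ev6E; apply: alg.
pose Q := {fraction {mpoly K[3]}}.
pose cQ : {rmorphism K -> Q} := tofrac \o mpolyC 3 (R := K).
pose T i : Q := tofrac 'X_i.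
have nT : T i2 != 0.
  rewrite tofrac_eq0; apply/eqP => /(congr1 (mcoeff U_(i2))).
  by rewrite mcoeffX mcoeff0 (eqxx U_(i2)%MM) => /eqP; rewrite oner_eq0.
(* The vectors (T_2, 0, -T_0) and (0, 1, -T_1/T_2) have cross product (T_0, T_1, T_2); multiplying
   them by M in [xm] and [ym] undoes the M^-1 in [tilde]. *)
pose x0 (i : 'I_3) : Q := nth (- T i0) [:: T i2; 0] i.
pose y0 (i : 'I_3) : Q := nth (- (T i1 / T i2)) [:: 0; 1] i.
pose xm j := \sum_k x0 k * cQ (M k j); pose ym j := \sum_k y0 k * cQ (M k j).
have [t tC tX] := msubst_exists cQ (xy6 xm ym).
apply/eqP => g0; have /eqP : t (g P) = 0 by rewrite g0 rmorph0.
have -> : t (g P) = tofrac P; last by rewrite tofrac_eq0 (negbTE nP).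
rewrite -[LHS]/((t \o g : {rmorphism _ -> _}) P).
apply: mpoly_rmorph_ext => [a|i]; first by transitivity (t (g a%:MP)); rewrite // gC tC.
transitivity (t (g 'X_i)) => //; rewrite gX.
have -> : t (cross c6 X6 Y6 i) = cross cQ xm ym i.
  apply: cross_morph => [a|j|j]; first exact: tC.
    by rewrite tX /xy6 split_lshift.
  by rewrite tX /xy6 split_rshift.
rewrite /cross !tilde_mul // /x0 /y0 -/(T i); move: i; apply: ord3P => /=.
- by rewrite mul0r mulr1 sub0r opprK.
- by rewrite mulr0 sub0r mulrN opprK mulrC divfK.
- by rewrite mulr1 mul0r subr0.
Qed.

End CrossProduct.

(** * Vector identities behind the change of generators *)

Section CrossIdentities.
Variables (S : comNzRingType) (x0 x1 x2 y0 y1 y2 l0 l1 l2 : S).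

(** A coordinate of (x × y) × l = (x·l) y - (y·l) x; up to sign, so is [cross_second]. *)
Lemma cross_first : (x0 * y1 - x1 * y0) * l0 - (x1 * y2 - x2 * y1) * l2 =
  y1 * (x0 * l0 + x1 * l1 + x2 * l2) + (- x1) * (y0 * l0 + y1 * l1 + y2 * l2).
Proof. ring. Qed.

Lemma cross_second : (x0 * y1 - x1 * y0) * l1 - (x2 * y0 - x0 * y2) * l2 =
  (- y0) * (x0 * l0 + x1 * l1 + x2 * l2) + x0 * (y0 * l0 + y1 * l1 + y2 * l2).
Proof. ring. Qed.

(** Orthogonality of x to x × y eliminates the product of x_2 with the last coordinate of x × y. *)
Lemma cross_span1 : (x0 * y1 - x1 * y0) * (x0 * l0 + x1 * l1 + x2 * l2) =
  x0 * ((x0 * y1 - x1 * y0) * l0 - (x1 * y2 - x2 * y1) * l2) +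
  x1 * ((x0 * y1 - x1 * y0) * l1 - (x2 * y0 - x0 * y2) * l2).
Proof. ring. Qed.

Lemma cross_span2 : (x0 * y1 - x1 * y0) * (y0 * l0 + y1 * l1 + y2 * l2) =
  y0 * ((x0 * y1 - x1 * y0) * l0 - (x1 * y2 - x2 * y1) * l2) +
  y1 * ((x0 * y1 - x1 * y0) * l1 - (x2 * y0 - x0 * y2) * l2).
Proof. ring. Qed.

End CrossIdentities.

(** * The ideals (f, g) and (V_1, V_2) agree *)

Section Pencil.
Variables (K F : closedFieldType) (iota : {rmorphism K -> F}).
Variables (s : 'I_3 -> {mpoly K[3]}) (M : 'M[K]_3) (x y : 'I_3 -> F).
Hypothesis uM : M \in unitmx.
Let z := cross M iota x y.
Let xt := tilde M iota x.
Let yt := tilde M iota y.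
Let l j : {mpoly F[3]} := imap iota (LS M s j).
Hypothesis z2 : z i2 != 0.

Lemma Vgen_tilde w :
  Vgen iota s w = tilde M iota w i0 *: l i0 + tilde M iota w i1 *: l i1 + tilde M iota w i2 *: l i2.
Proof.
have -> : tilde M iota w i0 *: l i0 + tilde M iota w i1 *: l i1 + tilde M iota w i2 *: l i2 =
    \sum_j tilde M iota w j *: l j.
  rewrite !big_ord_recl big_ord0 addr0 addrA; congr (_ + tilde _ _ _ _ *: l _); exact: val_inj.
rewrite /Vgen /tilde; under [in RHS]eq_bigr do rewrite scaler_suml.
rewrite exchange_big; apply: eq_bigr => i _ /=.
rewrite imapE {1}(LS_inv s i uM) rmorph_sum scaler_sumr; apply: eq_bigr => j _.
by rewrite -[_ *: LS M s j]mul_mpolyC rmorphM imapC mul_mpolyC scalerA.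
Qed.

Lemma in_loc_ideal_pencil a p :
  in_loc_ideal (fz iota s M z i0) (fz iota s M z i1) a p <->
  in_loc_ideal (Vgen iota s x) (Vgen iota s y) a p.
Proof.
have zE0 : z i0 = xt i1 * yt i2 - xt i2 * yt i1 by [].
have zE1 : z i1 = xt i2 * yt i0 - xt i0 * yt i2 by [].
have zE2 : z i2 = xt i0 * yt i1 - xt i1 * yt i0 by [].
have supV w : z i2 *: Vgen iota s w = tilde M iota w i0 *: fz iota s M z i0 +
     tilde M iota w i1 *: fz iota s M z i1 ->
  exists c d : F, Vgen iota s w = c *: fz iota s M z i0 + d *: fz iota s M z i1.
  move=> E; exists (tilde M iota w i0 / z i2), (tilde M iota w i1 / z i2).
  rewrite ![_ / z i2]mulrC -!scalerA -scalerDr -E scalerA mulVf ?scale1r //.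
split; apply: in_loc_ideal_sub.
- exists (yt i1), (- xt i1); rewrite !Vgen_tilde /fz zE0 zE2 -/xt -/yt -/(l _) -/(l _).
  rewrite -!mul_mpolyC !(mpolyCB, mpolyCM, mpolyCN); exact: cross_first.
- exists (- yt i0), (xt i0); rewrite !Vgen_tilde /fz zE1 zE2 -/xt -/yt -/(l _) -/(l _).
  rewrite -!mul_mpolyC !(mpolyCB, mpolyCM, mpolyCN); exact: cross_second.
- apply: supV; rewrite !Vgen_tilde /fz zE0 zE1 zE2 -/xt -/yt -!/(l _).
  rewrite -!mul_mpolyC !(mpolyCB, mpolyCM, mpolyCN); exact: cross_span1.
- apply: supV; rewrite !Vgen_tilde /fz zE0 zE1 zE2 -/xt -/yt -!/(l _).
  rewrite -!mul_mpolyC !(mpolyCB, mpolyCM, mpolyCN); exact: cross_span2.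
Qed.

End Pencil.

(** * Points of the plane other than (0:0:1) *)

Section Points.
Variable K : fieldType.
Implicit Types (o : option K) (b : K).

Lemma pt_nonzero o b : nonzero3 (pt o b).
Proof.
case: o => [y|]; [exists i0 | exists i1]; rewrite /pt /= ?hornerC ?oner_eq0 //.
Qed.

Lemma pt_inj o o' b b' : proportional3 (pt o b) (pt o' b') -> (o, b) = (o', b').
Proof.
move=> [c [nc E]]; have := E i0; have := E i1; have := E i2; rewrite /pt /=.
case: o {E} => [y|]; case: o' => [y'|] /=;
  rewrite !(hornerD, hornerX, hornerC, add0r, mulr0, mulr1) => e2 e1 e0.
- by rewrite -e0 !mul1r in e1 e2; rewrite e1 e2.
- by move/eqP: e0; rewrite oner_eq0.
- by move/eqP: nc; rewrite -e0.
- by rewrite -e1 mul1r in e2; rewrite e2.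
Qed.

Lemma pt_cover (a : 'I_3 -> K) : (a i0 != 0) || (a i1 != 0) ->
  exists o b, proportional3 a (pt o b).
Proof.
have [a0 /= a1|a0 _] := eqVneq (a i0) 0; last first.
  exists (Some (a i1 / a i0)), (a i2 / a i0), (a i0); split=> //.
  apply: ord3P; rewrite /pt /= ?(hornerD, hornerX, hornerC) ?add0r ?mulr1 //;
    by rewrite mulrC divfK.
exists None, (a i2 / a i1), (a i1); split=> //.
by apply: ord3P; rewrite /pt /= ?(hornerX, hornerC) ?mulr0 ?mulr1 // mulrC divfK.
Qed.

Lemma homog_proportional (p : {mpoly K[3]}) d a a' : p \is d.-homog ->
  proportional3 a a' -> p.@[a] = 0 -> p.@[a'] = 0.
Proof.
move=> hp [c [nc E]].
have -> : p.@[a] = c ^+ d * p.@[a'].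
  have := @homog_scale 3 K K (meval a) (meval a') c d p; apply=> // [e|i] /=.
    by rewrite !mevalC.
  by rewrite !mevalXU E.
by move/eqP; rewrite mulf_eq0 expf_eq0 (negbTE nc) andbF => /eqP.
Qed.

Lemma base_point_pt (s : 'I_3 -> {mpoly K[3]}) d a :
  (forall i, s i \is d.-homog) -> (exists i, (s i).@[e3 K] != 0) -> base_point s a ->
  exists o b, proportional3 a (pt o b) /\ forall i, (s i).@[pt o b] = 0.
Proof.
move=> hs [i ni] [[k nk] s0].
have [a01|] := boolP ((a i0 != 0) || (a i1 != 0)).
  have [o [b ab]] := pt_cover a01; exists o, b; split=> // j.
  exact: homog_proportional (hs j) ab (s0 j).
rewrite negb_or !negbK => /andP[/eqP a0 /eqP a1]; case/eqP: ni.
apply: homog_proportional (hs i) _ (s0 i).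
exists (a i2); split; last first.
  by apply: ord3P; rewrite /e3 /= ?mulr0 ?mulr1.
by move: k nk; apply: ord3P => //; rewrite ?a0 ?a1 eqxx.
Qed.

End Points.

Lemma In_mapP (T : eqType) (S : Type) (f : T -> S) (r : seq T) a :
  List.In a (map f r) <-> exists2 t, t \in r & a = f t.
Proof.
elim: r => [|t r IH] /=; first by split=> // -[].
split=> [[<-|/IH[u ur ->]]|[u]]; first by exists t; rewrite ?mem_head.
  by exists u; rewrite // inE ur orbT.
by rewrite inE => /orP[/eqP-> ->|ur aE]; [left|right; apply/IH; exists u].
Qed.

Lemma sum_count_undup (T : eqType) (r : seq T) :
  (\sum_(t <- undup r) count_mem t r)%N = size r.
Proof.
rewrite -sum1_size -[RHS]big_undup_iterop_count; apply: eq_bigr => t _.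
by rewrite Monoid.iteropE iter_addn_0 mul1n.
Qed.

(** * Base points and the sum of their multiplicities *)

Section BasePoints.
Variables (K F : closedFieldType) (iota : {rmorphism K -> F}).
Variables (s : 'I_3 -> {mpoly K[3]}) (d : nat) (M : 'M[K]_3) (z : 'I_3 -> F).
Hypothesis hs : forall i, s i \is d.-homog.
Hypothesis lead2 : (LS M s i2).@[e3 K] != 0.
Hypothesis uM : M \in unitmx.
Hypothesis gen_z : forall P : {mpoly K[3]}, P != 0 -> genev iota z P != 0.
Local Notation f0 := (fz iota s M z i0).
Local Notation f1 := (fz iota s M z i1).
Local Notation I_ o := (ideal2 (aff (omap iota o) f0) (aff (omap iota o) f1)).

Lemma ideal2_gen (f g : {poly {poly F}}) : ideal2 f g f /\ ideal2 f g g.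
Proof.
split; [exists 1, 1, 0 | exists 1, 0, 1]; rewrite hornerC oner_neq0 !mul1r mul0r.
  by rewrite addr0.
by rewrite add0r.
Qed.

(** The labels of the chain are common zeros of f and g, hence base points defined over K;
    conversely all L_j, and with them f and g, vanish at a base point. *)
Lemma fiber_base o D P' : toX (ResJ M s) = lins D *: P' ->
  (exists mu, (P'@_mu).@[dir o] != 0) ->
  exists pb : seq K, [/\ chain (I_ o) (map iota pb), size pb = count_mem o D &
    forall b, b \in pb <-> forall i, (s i).@[pt o b] = 0].
Proof.
move=> RE nmu; have [bs [ch sb]] := fiber_chain hs lead2 gen_z RE nmu.
have [g0 g1] := ideal2_gen (aff (omap iota o) f0) (aff (omap iota o) f1).
have iI := is_ideal2 (aff (omap iota o) f0) (aff (omap iota o) f1).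
have base b : b \in bs -> exists2 b', b = iota b' & forall i, (s i).@[pt o b'] = 0.
  move=> bbs; apply: (common_zero_base hs lead2 uM gen_z);
    by rewrite -ev_aff; apply: chain_mem_ev iI ch bbs _.
have [pb pbE] : exists pb, bs = map iota pb.
  elim: bs base {ch sb} => [|b bs IH] base; first by exists [::].
  have [|pb ->] := IH; first by move=> b' b'bs; apply: base; rewrite inE b'bs orbT.
  by have [b' -> _] := base b (mem_head _ _); exists (b' :: pb).
rewrite pbE in ch sb base; exists pb; split=> //; first by rewrite -sb size_map.
move=> b; split=> [bpb|s0].
  have [b' /fmorph_inj -> //] := base (iota b) (map_f iota bpb).
rewrite -(mem_map (fmorph_inj iota)).
have L0 j : (imap iota (LS M s j)).@[pt (omap iota o) (iota b)] = 0.
  rewrite -line_imap horner_map line_ev -[RHS](rmorph0 iota); congr (iota _).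
  rewrite /LS rmorph_sum big1 // => k _.
  by rewrite /= mevalZ s0 mulr0.
by apply: chain_ev_mem ch _ _; rewrite ev_aff /fz mevalB !mevalZ !L0 !mulr0 subr0.
Qed.

(** Turns the existence in [fiber_base] into a function of the direction, one entry of a finite list
    at a time. *)
Lemma base_list (D : seq (option K)) P' : toX (ResJ M s) = lins D *: P' ->
  (forall o, exists mu, (P'@_mu).@[dir o] != 0) ->
  forall E : seq (option K), exists pb : option K -> seq K, forall o, o \in E ->
   [/\ chain (I_ o) (map iota (pb o)), size (pb o) = count_mem o D &
    forall b, b \in pb o <-> forall i, (s i).@[pt o b] = 0].
Proof.
move=> RE nmu; elim=> [|o E [pb IH]]; first by exists (fun=> [::]).
have [po Ho] := fiber_base RE (nmu o).
exists (fun o' => if o' == o then po else pb o') => o'; rewrite inE.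
by case: eqP => [->|_] //=; apply: IH.
Qed.

Lemma base_multiplicities (x y : 'I_3 -> F) (D : seq (option K)) P' :
  (forall a p, in_loc_ideal f0 f1 a p <->
    in_loc_ideal (Vgen iota s x) (Vgen iota s y) a p) ->
  (exists i, (s i).@[e3 K] != 0) ->
  toX (ResJ M s) = lins D *: P' ->
  (forall o, exists mu, (P'@_mu).@[dir o] != 0) ->
  exists (reps : seq ('I_3 -> K)) (ms : seq nat),
    [/\ base_reps s reps, size ms = size reps,
        (forall (i : nat) a, (i < size reps)%N ->
           imult_is (Vgen iota s x) (Vgen iota s y)
                    (fun k => iota (nth a reps i k)) (nth 0%N ms i))
      & (\sum_(m <- ms) m)%N = size D].
Proof.
move=> pen ns RE nmu; have [pb Hpb] := base_list RE nmu (undup D).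
pose T := [seq (o, b) | o <- undup D, b <- undup (pb o)].
have TP o b : (o, b) \in T <-> forall i, (s i).@[pt o b] = 0.
  split=> [/allpairsPdep[o' [b' [oD]]]|s0].
    by rewrite mem_undup => bp [-> ->]; have [_ _ H] := Hpb o' oD; apply/H.
  (* A base point in direction o makes the list of that direction nonempty, and the length of the
     list is the number of occurrences of o in D. *)
  have oD : o \in undup D.
    have [po [ch sp H]] := fiber_base RE (nmu o).
    rewrite mem_undup -has_pred1 has_count -sp; move/H: s0.
    by case: (po).
  apply/allpairsPdep; exists o, b; split=> //; rewrite mem_undup.
  by have [_ _ H] := Hpb o oD; apply/H.
have uT : uniq T.
  apply: allpairs_uniq_dep => [|o _|]; try exact: undup_uniq.
  by move=> [o b] [o' b'] _ _ /= [-> ->].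
exists [seq pt t.1 t.2 | t <- T], [seq count_mem t.2 (pb t.1) | t <- T]; split.
- split; [|split].
  + move=> a /In_mapP[[o b] /TP s0 ->]; split=> //; exact: pt_nonzero.
  + move=> a /(base_point_pt hs ns)[o [b [ab /TP obT]]].
    by exists (pt o b) => //; apply/In_mapP; exists (o, b).
  + move=> i j a; rewrite size_map => iT jT nij.
    have t0 : option K * K := (None, 0).
    rewrite !(nth_map t0) // => /pt_inj; rewrite -!surjective_pairing => /eqP.
    by rewrite nth_uniq // (negbTE nij).
- by rewrite !size_map.
- move=> i a; rewrite size_map => iT.
  pose t0 : option K * K := (None, 0).
  rewrite !(nth_map t0) //; have := mem_nth t0 iT.
  case: (nth t0 T i) => o b /= /allpairsPdep[o' [b' [oD _ [-> ->]]]].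
  have [ch _ _] := Hpb o' oD.
  have ptE : pt (omap iota o') (iota b') =1 (fun k => iota (pt o' b' k)).
    apply: ord3P; rewrite /pt //=; case: (o') => [c|] /=;
      by rewrite ?(hornerD, hornerX, hornerC, add0r) ?rmorph0 ?rmorph1.
  have h0 : f0 \is d.-homog by apply: homog_fz.
  have h1 : f1 \is d.-homog by apply: homog_fz.
  have := imult_codim (iota b') h0 h1 ch.
  rewrite count_map (@eq_count _ _ (pred1 b')); last first.
    by move=> c /=; rewrite (inj_eq (fmorph_inj iota)).
  apply: imult_is_eq => p; split=> [H|/pen H].
    by apply/pen; apply: in_loc_ideal_pt H.
  by apply: in_loc_ideal_pt H => k; rewrite ptE.
rewrite big_map big_allpairs_dep /= -(sum_count_undup D).
rewrite [LHS]big_seq [RHS]big_seq; apply: eq_bigr => o oD.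
by have [_ <- _] := Hpb o oD; rewrite sum_count_undup.
Qed.

End BasePoints.

(** * The open set and the formula *)

Theorem theorem3p4 (K : closedFieldType) (s : 'I_3 -> {mpoly K[3]}) :
  [pchar K] =i pred0 ->
  dominant s ->
  same_degree_homog s ->
  coprime3 s ->
  (forall i, (s i).@[e3 K] != 0) ->
  exists Om : 'M[K]_3 -> Prop,
    [/\ zariski_open_PGL3 Om, (exists M, Om M) &
        forall M : 'M[K]_3, Om M ->
          exists c : {mpoly K[2]},
            is_content_x (ResJ M s) c /\ mult_base_is s (deg_t c)].
Proof.
move=> _ _ [d hs] cop se.
have LSe (M : 'M[K]_3) i : (LS M s i).@[e3 K] = \sum_j M i j * (s j).@[e3 K].
  by rewrite /LS rmorph_sum; apply: eq_bigr => j _; rewrite /= mevalZ.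
(* L_3(0:0:1) is a linear form in the third row of M; the identity satisfies the condition because
   s_3(0:0:1) is nonzero. *)
exists (fun M => M \in unitmx /\ (LS M s i2).@[e3 K] != 0); split.
- split.
    pose p : {mpoly K[3 * 3]} := \sum_j (s j).@[e3 K] *: 'X_(mxvec_index i2 j).
    exists [:: p] => M.
    have pE : p.@[fun i => mxvec M 0 i] = (LS M s i2).@[e3 K].
      rewrite LSe /p rmorph_sum; apply: eq_bigr => j _.
      by rewrite /= mevalZ mevalXU mxvecE mulrC.
    split=> [[uM nM]|[uM [q]]]; first by split=> //; exists p; rewrite ?mem_head ?pE.
    by rewrite inE => /eqP ->; rewrite pE.
  move=> M c nc [uM nM]; split; first by rewrite unitmxZ ?unitfE.
  rewrite LSe in nM; rewrite LSe; under eq_bigr do rewrite mxE -mulrA.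
  by rewrite -mulr_sumr mulf_neq0.
- exists 1%:M; rewrite unitmx1 LSe (bigD1 i2) //= mxE eqxx mul1r big1 ?addr0; first by split.
  by move=> j nj; rewrite mxE eq_sym (negbTE nj) mul0r.
move=> M [uM lead2].
have ns : exists i, s i != 0.
  by exists i0; apply: contraNneq (se i0) => ->; rewrite meval0.
have gen (F : closedFieldType) (iota : {rmorphism K -> F}) (x y : 'I_3 -> F) :
    is_alg_closure_Kxy iota x y ->
    forall P, P != 0 -> genev iota (cross M iota x y) P != 0.
  by move=> [alg _]; apply: cross_generic.
(* [ResJ_neq0] needs a generic point, available only once F, x, y are given. So c is chosen first
   even for a zero resultant, and any F supplied afterwards yields the contradiction. *)
have [R0|nR] := eqVneq (ResJ M s) 0.
  exists 0; split.
    rewrite R0; split=> [mu|e _]; last by exists 0; rewrite mul0r.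
    by exists 0; rewrite -mcoeff_toX rmorph0 mcoeff0 mul0r.
  move=> F iota x y /gen gen_z.
  by have := ResJ_neq0 hs lead2 uM gen_z cop ns; rewrite R0 eqxx.
have [D [P' [RE nmu gD]]] := content_decomp (toX_neq0 nR) (homog_ResJ hs lead2).
exists (lins D); split.
  split=> [mu|e He].
    by exists (P'@_mu); rewrite -mcoeff_toX RE mcoeffZ mulrC.
  by apply: gD => mu; rewrite mcoeff_toX.
rewrite deg_lins => F iota x y /gen gen_z.
have z2 : cross M iota x y i2 != 0 by apply: gen_z_neq0 gen_z i2.
apply: (base_multiplicities hs lead2 uM gen_z) RE nmu; last by exists i0.
by move=> a p; apply: in_loc_ideal_pencil.
Qed.
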